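(* Let $2\leq s<\infty$ be an integer and let $\{5,3\}$ denote the dodecahedron. Then $2^{\{5,3\},\mathcal{G}(s)}$ is a regular $4$-polytope of type $\{4,5,3\}$ with automorphism group $D_s^{10}\rtimes[5,3]$ of order $120\cdot(2s)^{10}$. Moreover, the group $G(2^{\{5,3\},\mathcal{G}(s)})=\langle\rho_0,\rho_1,\rho_2,\rho_3\rangle$ is the quotient of the Coxeter group $[4,5,3]$ by the relations $$(\rho_0\beta^{-i}\rho_0\beta^i)^2=id\ \text{ for } 2\leq i\leq 4,\quad\text{and}\quad(\rho_0\beta^5\rho_0\beta^5)^s=id,$$ where $\beta=\rho_1\rho_2\rho_3$.
   Context: C-groups and polytopes: a C-group of rank $m$ is a group $G$ with generating involutions $\rho_0,\dots,\rho_{m-1}$ satisfying $\langle\rho_i\mid i\in I\rangle\cap\langle\rho_j\mid j\in J\rangle=\langle\rho_k\mid k\in I\cap J\rangle$ for all $I,J\subseteq\{0,\dots,m-1\}$; it is a string C-group if $(\rho_i\rho_j)^2=id$ whenever $|i-j|\geq 2$. Abstract regular polytopes $\mathcal{P}$ of rank $m$ are in one-to-one correspondence with string C-groups $G(\mathcal{P})$ of rank $m$: the $i$-faces are the right cosets of $\langle\rho_j\mid j\neq i\rangle$, and vertices are the $0$-faces. The Schläfli type is $\{p_1,\dots,p_{m-1}\}$, $p_i$ being the order of $\rho_{i-1}\rho_i$, and $[p_1,\dots,p_{m-1}]$ denotes the corresponding Coxeter group with linear diagram. Construction of $2^{\mathcal{P},\mathcal{G}(s)}$: let $\mathcal{P}$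 be a centrally symmetric regular $n$-polytope with group $G(\mathcal{P})=\langle\tau_0,\dots,\tau_{n-1}\rangle$, i.e. $G(\mathcal{P})$ has a proper central involution $\alpha$ fixing no vertex. Let $F_0$ be the base vertex, stabilized by $\langle\tau_1,\dots,\tau_{n-1}\rangle$. Let $W$ be the Coxeter group generated by involutions $\sigma_F$, one for each vertex $F$ of $\mathcal{P}$, with defining relations $\sigma_F^2=id$, $(\sigma_F\sigma_{F\alpha})^s=id$, and $(\sigma_F\sigma_{F'})^2=id$ for $F'\notin\{F,F\alpha\}$; so $W\cong D_s^{q}$, where $q$ is half the number of vertices and $D_s$ is the dihedral group of order $2s$. The group $G(\mathcal{P})$ acts on $W$ by $\tau^{-1}\sigma_F\tau=\sigma_{F\tau}$. Then $2^{\mathcal{P},\mathcal{G}(s)}$ is the regular $(n+1)$-polytope with group $G(2^{\mathcal{P},\mathcal{G}(s)}):=W\rtimes G(\mathcal{P})=\langle\rho_0,\dots,\rho_n\rangle$, where $\rho_0:=\sigma_{F_0}$ and $\rho_i:=\tau_{i-1}$ for $1\leq i\leq n$. For the dodecahedron, $G(\mathcal{P})=[5,3]$ has order $120$, there are $20$ vertices, and $\alpha=(\tau_0\tau_1\tau_2)^5$. *)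

(* Defs.v *)
(* Groups may be infinite (the Coxeter group [4,5,3] is), so they are
   [groupType]s of monoid.v rather than [finGroupType]s. *)
From HB Require Import structures.
From mathcomp Require Import all_boot monoid fingroup extremal generic_quotient.
From mathcomp Require Import boolp classical_sets functions cardinality.

Set Implicit Arguments.
Unset Strict Implicit.
Unset Printing Implicit Defensive.

Local Open Scope quotient_scope.
Local Open Scope group_scope.
Local Open Scope classical_set_scope.
Local Open Scope card_scope.

Definition is_subgroup (G : groupType) (H : set G) : Prop :=
  [/\ H 1, (forall x y, H x -> H y -> H (x * y)) & (forall x, H x -> H x^-1)].

Definition is_normal_subgroup (G : groupType) (H : set G) : Prop :=
  is_subgroup H /\ forall x y, H x -> H (x ^ y).

Definition generated (G : groupType) (A : set G) : set G :=
  smallest (@is_subgroup G) A.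

Definition normal_closure (G : groupType) (A : set G) : set G :=
  smallest (@is_normal_subgroup G) A.

Definition right_coset (G : groupType) (H : set G) (g : G) : set G :=
  [set h * g | h in H].

Definition right_cosets (G : groupType) (H : set G) : set (set G) :=
  range (right_coset H).

Definition isomorphic (G H : groupType) : Prop :=
  exists f : {multiplicative G -> H}, bijective f.

Definition has_order (G : groupType) (x : G) (k : nat) : Prop :=
  [/\ (0 < k)%N, x ^+ k = 1 &
      forall j, (0 < j)%N -> x ^+ j = 1 -> (k <= j)%N].

(* The library's 'D_m is the dihedral group of order m; for m = 4 it is the
   Klein four-group. *)
Definition dihedral (s : nat) : groupType := ('D_(2 * s))%type.

(* A letter [(x, false)] stands for the generator x and [(x, true)] for its
   inverse. *)
Notation word I := (seq (I * bool)).

Section Presentation.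
Variables (I : choiceType) (R : set (word I)).

Inductive word_eq : word I -> word I -> Prop :=
| word_eq_refl w : word_eq w w
| word_eq_sym u v : word_eq u v -> word_eq v u
| word_eq_trans u v w : word_eq u v -> word_eq v w -> word_eq u w
| word_eq_cat u u' v v' :
    word_eq u u' -> word_eq v v' -> word_eq (u ++ v) (u' ++ v')
| word_eq_cancel x b : word_eq [:: (x, b); (x, ~~ b)] [::]
| word_eq_relator r : R r -> word_eq r [::].

Definition word_eqb (u v : word I) : bool := `[< word_eq u v >].

Lemma word_eqb_equiv : equiv_class_of word_eqb.
Proof.
split=> [u|u v|v u w]; first by apply/asboolP; exact: word_eq_refl.
  by apply/asboolP/asboolP; exact: word_eq_sym.
move=> /asboolP uv /asboolP vw; apply/asboolP; exact: word_eq_trans uv vw.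
Qed.

Canonical word_equiv := EquivRelPack word_eqb_equiv.

Definition presented := {eq_quot word_equiv}.
HB.instance Definition _ := Choice.on presented.
HB.instance Definition _ := EqQuotient.on presented.

Local Notation cls := (\pi_presented)%qT.

Definition winv (w : word I) : word I := rev [seq (a.1, ~~ a.2) | a <- w].

Definition pone : presented := cls [::].
Definition pmul (x y : presented) : presented := cls (repr x ++ repr y).
Definition pinv (x : presented) : presented := cls (winv (repr x)).

Lemma clsP u v : cls u = cls v <-> word_eq u v.
Proof.
by split=> [/eqmodP/asboolP|uv]; [|apply/eqmodP/asboolP].
Qed.

Lemma repr_cls u : word_eq (repr (cls u)) u.
Proof. by apply/clsP; rewrite reprK. Qed.

Lemma pmulE u v : pmul (cls u) (cls v) = cls (u ++ v).
Proof. by apply/clsP/word_eq_cat; exact: repr_cls. Qed.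

Lemma winvK : involutive winv.
Proof.
by move=> w; rewrite /winv map_rev revK -map_comp map_id_in // => -[x b] _ /=;
  rewrite negbK.
Qed.

Lemma winv_r u : word_eq (u ++ winv u) [::].
Proof.
elim: u => [|[x b] u IH]; first exact: word_eq_refl.
have -> : ((x, b) :: u) ++ winv ((x, b) :: u) =
    [:: (x, b)] ++ (u ++ winv u) ++ [:: (x, ~~ b)].
  by rewrite /winv /= rev_cons -cats1 catA.
apply: word_eq_trans (word_eq_cancel x b).
apply: word_eq_cat (word_eq_refl _) _.
exact: word_eq_cat IH (word_eq_refl [:: (x, ~~ b)]).
Qed.

Lemma pmulA : associative pmul.
Proof.
move=> x y z; rewrite -[x]reprK -[y]reprK -[z]reprK.
move: (repr x) (repr y) (repr z) => u v w.
by rewrite (pmulE v w) (pmulE u v) (pmulE u) (pmulE _ w) catA.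
Qed.

Lemma pmul1 : left_id pone pmul.
Proof. by move=> x; rewrite -[x]reprK [LHS]pmulE. Qed.

Lemma pmulr1 : right_id pone pmul.
Proof. by move=> x; rewrite -[x]reprK [LHS]pmulE cats0. Qed.

Lemma pmulrV : right_inverse pone pinv pmul.
Proof.
move=> x; rewrite /pinv -{1}[x]reprK [LHS]pmulE; apply/clsP; exact: winv_r.
Qed.

Lemma pmulV : left_inverse pone pinv pmul.
Proof.
move=> x; rewrite /pinv -{2}[x]reprK [LHS]pmulE; apply/clsP.
by rewrite -{2}[repr x]winvK; exact: winv_r.
Qed.

HB.instance Definition _ :=
  isGroup.Build presented pmulA pmul1 pmulr1 pmulV pmulrV.

Definition pgen (x : I) : presented := cls [:: (x, false)].

Lemma presentedM u v : cls u * cls v = cls (u ++ v) :> presented.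
Proof. exact: pmulE. Qed.

Section Lift.
Variables (G : groupType) (f : I -> G).

Definition weval (w : word I) : G :=
  foldr (fun a x => (if a.2 then (f a.1)^-1 else f a.1) * x) 1 w.

Lemma weval_cat u v : weval (u ++ v) = weval u * weval v.
Proof. by elim: u => [|a u IH] /=; rewrite ?mul1g // IH mulgA. Qed.

Definition plift (x : presented) : G := weval (repr x).

Hypothesis fR : forall r, R r -> weval r = 1.

Lemma weval_eq u v : word_eq u v -> weval u = weval v.
Proof.
elim=> {u v} [//|//|u v w _ -> _ -> //|u u' v v' _ e _ e'|x []|r Rr].
- by rewrite !weval_cat e e'.
- by rewrite /= mulg1 mulVg.
- by rewrite /= mulg1 mulgV.
- exact: fR.
Qed.

Lemma pliftE w : plift (cls w) = weval w.
Proof. exact/weval_eq/repr_cls. Qed.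

Lemma pliftM : {morph plift : x y / x * y}.
Proof.
move=> x y; rewrite -[x]reprK -[y]reprK presentedM.
by rewrite !pliftE weval_cat.
Qed.

Lemma plift_gen x : plift (pgen x) = f x.
Proof. by rewrite pliftE /= mulg1. Qed.

End Lift.

Lemma cls_weval w : cls w = weval pgen w.
Proof.
elim: w => [//|[x b] w IH]; rewrite -cat1s -presentedM IH /=; congr (_ * _).
case: b => //; apply: (mulgI (pgen x)); rewrite mulgV presentedM.
apply/clsP; exact: word_eq_cancel x false.
Qed.

Lemma weval_pgen r : R r -> weval pgen r = 1.
Proof. by move=> Rr; rewrite -cls_weval; apply/clsP/word_eq_relator. Qed.

Lemma pmorph_ext (G : groupType) (f g : presented -> G) :
  {morph f : x y / x * y} -> {morph g : x y / x * y} ->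
  (forall x, f (pgen x) = g (pgen x)) -> f =1 g.
Proof.
move=> fM gM fg x; rewrite -[x]reprK.
have m1 (h : presented -> G) : {morph h : x y / x * y} -> h 1 = 1.
  by move=> hM; apply: (mulgI (h 1)); rewrite -hM !mulg1.
have mV (h : presented -> G) y : {morph h : x y / x * y} -> h y^-1 = (h y)^-1.
  by move=> hM; apply: (mulgI (h y)); rewrite -hM !mulgV m1.
rewrite cls_weval; elim: (repr x) => [|[y b] w IH] /=; first by rewrite !m1.
by rewrite fM gM IH; case: b; rewrite ?mV ?fg.
Qed.

End Presentation.

(* The entry 0 of a Coxeter matrix encodes an infinite order: the relator is
   then the empty word. *)
Definition coxeter_relators (I : choiceType) (m : I -> I -> nat) :
    set (word I) :=
  [set r | exists i j,
     r = flatten (nseq (m i j) [:: (i, false); (j, false)])].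

Definition coxeter (I : choiceType) (m : I -> I -> nat) : groupType :=
  presented (coxeter_relators m).

Definition cgen (I : choiceType) (m : I -> I -> nat) (i : I) : coxeter m :=
  pgen (coxeter_relators m) i.

Lemma weval_coxeter (I : choiceType) (G : groupType) (f : I -> G) i j k :
  weval f (flatten (nseq k [:: (i, false); (j, false)])) = (f i * f j) ^+ k.
Proof. by elim: k => //= k IH; rewrite expgS -mulgA IH. Qed.

Lemma cgen_rel (I : choiceType) (m : I -> I -> nat) i j :
  (cgen m i * cgen m j) ^+ m i j = 1.
Proof.
rewrite -weval_coxeter; apply: weval_pgen; exists i, j.
reflexivity.
Qed.

(* The linear diagram [p_1, ..., p_(m-1)], on m nodes indexed from 0. *)
Definition string_matrix (p : seq nat) (i j : 'I_(size p).+1) : nat :=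
  if i == j then 1%N
  else if (i.+1 == j) || (j.+1 == i) then nth 0%N p (minn i j) else 2.

Definition string_coxeter (p : seq nat) : groupType :=
  coxeter (@string_matrix p).

Record raction (G W : groupType) := RAction {
  ract :> W -> G -> W;
  ractM : forall g, {morph ract^~ g : u v / u * v};
  ract1 : forall w, ract w 1 = w;
  ract_mul : forall w g h, ract w (g * h) = ract (ract w g) h }.

(* [SDPair to g w] is the product g w, and w g = g (to w g): the action is
   conjugation, to w g = g^-1 w g. *)
Record sdprod_of (G W : groupType) (to : raction G W) :=
  SDPair { sd1 : G; sd2 : W }.
Arguments SDPair {G W} to.

Section SemiDirect.
Variables (G W : groupType) (to : raction G W).

HB.instance Definition _ := gen_eqMixin (sdprod_of to).
HB.instance Definition _ := gen_choiceMixin (sdprod_of to).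

Definition sdone := SDPair to 1 1.
Definition sdmul (x y : sdprod_of to) :=
  SDPair to (sd1 x * sd1 y) (to (sd2 x) (sd1 y) * sd2 y).
Definition sdinv (x : sdprod_of to) :=
  SDPair to (sd1 x)^-1 (to (sd2 x)^-1 (sd1 x)^-1).

Lemma ract_1 g : to 1 g = 1.
Proof. by apply: (mulgI (to 1 g)); rewrite -ractM !mulg1. Qed.

Lemma sdmulA : associative sdmul.
Proof.
move=> [g u] [h v] [k w]; rewrite /sdmul /=.
by rewrite ractM ract_mul !mulgA.
Qed.

Lemma sdmul1 : left_id sdone sdmul.
Proof. by case=> g w; rewrite /sdmul /= ract_1 !mul1g. Qed.

Lemma sdmulr1 : right_id sdone sdmul.
Proof. by case=> g w; rewrite /sdmul /= ract1 !mulg1. Qed.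

Lemma sdmulV : left_inverse sdone sdinv sdmul.
Proof.
by case=> g w; rewrite /sdmul /sdinv /= -ract_mul !mulVg ract1 mulVg.
Qed.

Lemma sdmulrV : right_inverse sdone sdinv sdmul.
Proof.
by case=> g w; rewrite /sdmul /sdinv /= -ractM !mulgV ract_1.
Qed.

HB.instance Definition _ :=
  isGroup.Build (sdprod_of to) sdmulA sdmul1 sdmulr1 sdmulV sdmulrV.

Definition semidirect : groupType := sdprod_of to.

End SemiDirect.

Section StringCGroup.
Variables (G : groupType) (m : nat) (rho : 'I_m -> G).

Definition C_group : Prop :=
  [/\ generated (range rho) = setT,
      forall i, has_order (rho i) 2 &
      forall I J : set 'I_m,
        generated (rho @` I) `&` generated (rho @` J) =
        generated (rho @` (I `&` J))].

Definition string_C_group : Prop :=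
  C_group /\
  forall i j : 'I_m, (i.+2 <= j)%N || (j.+2 <= i)%N ->
    (rho i * rho j) ^+ 2 = 1.

Definition schlafli_type (p : seq nat) : Prop :=
  (size p).+1 = m /\
  forall i j : 'I_m, i.+1 = j -> has_order (rho i * rho j) (nth 0%N p i).

End StringCGroup.

Section Polytope.
Variables (T : Type) (le : T -> T -> Prop).

Definition slt x y : Prop := le x y /\ x <> y.

Definition chain (C : set T) : Prop :=
  forall x y, C x -> C y -> le x y \/ le y x.

Definition flag (C : set T) : Prop :=
  chain C /\ forall D, chain D -> C `<=` D -> D = C.

Definition adjacent (C D : set T) : Prop :=
  C `\` D #= `I_1 /\ D `\` C #= `I_1.

(* [flag_connected A C D]: C and D are joined by a sequence of successively
   adjacent flags, all of them containing A. *)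
Inductive flag_connected (A : set T) : set T -> set T -> Prop :=
| flag_connected0 C : flag C -> A `<=` C -> flag_connected A C C
| flag_connectedS C D E : flag C -> A `<=` C -> adjacent C D ->
    flag_connected A D E -> flag_connected A C E.

(* Ranks are shifted by one: a face of rank -1, 0, ..., n of an n-polytope has
   [rank] 0, 1, ..., n.+1. *)
Definition polytope (n : nat) (rank : T -> nat) : Prop :=
  [/\ [/\ forall x, le x x,
          forall x y, le x y -> le y x -> x = y &
          forall x y z, le x y -> le y z -> le x z],
      (exists x, forall y, le x y) /\ (exists x, forall y, le y x),
      [/\ forall x, (rank x <= n.+1)%N,
          forall x y, slt x y -> (rank x < rank y)%N &
          forall C, flag C -> C #= `I_n.+2],
      forall C D, flag C -> flag D -> flag_connected (C `&` D) C D &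
      forall x y, le x y -> rank y = (rank x).+2 ->
        [set z | slt x z /\ slt z y] #= `I_2].

Record automorphism := Automorphism {
  aut_fun :> T -> T;
  aut_inv : T -> T;
  aut_funK : cancel aut_fun aut_inv;
  aut_invK : cancel aut_inv aut_fun;
  aut_le : forall x y, le (aut_fun x) (aut_fun y) <-> le x y }.

Definition regular_polytope (n : nat) (rank : T -> nat) : Prop :=
  polytope n rank /\
  forall C D, flag C -> flag D -> exists f : automorphism, f @` C = D.

HB.instance Definition _ := gen_eqMixin automorphism.
HB.instance Definition _ := gen_choiceMixin automorphism.

Lemma aut_ext (f g : automorphism) : f =1 g -> f = g.
Proof.
case: f g => [f f' fK f'K fle] [g g' gK g'K gle] /= /funext fg.
subst g; have ? : f' = g' by apply/funext => x; rewrite -[x in LHS]g'K fK.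
subst g'; congr Automorphism; exact: Prop_irrelevance.
Qed.

Definition aut1 : automorphism :=
  @Automorphism id id (fun=> erefl) (fun=> erefl) (fun x y => iff_refl _).

(* Automorphisms act on the right: f * g is f followed by g. *)
Program Definition autM (f g : automorphism) :=
  @Automorphism (g \o f) (aut_inv f \o aut_inv g) _ _ _.
Next Obligation. by move=> x /=; rewrite !aut_funK. Qed.
Next Obligation. by move=> x /=; rewrite !aut_invK. Qed.
Next Obligation. by rewrite /= !aut_le; split. Qed.

Program Definition autV (f : automorphism) :=
  @Automorphism (aut_inv f) f (@aut_invK f) (@aut_funK f) _.
Next Obligation. by rewrite -(aut_le f) !aut_invK. Qed.

Lemma autA : associative autM. Proof. by move=> f g h; exact: aut_ext. Qed.
Lemma aut1M : left_id aut1 autM. Proof. by move=> f; exact: aut_ext. Qed.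
Lemma autM1 : right_id aut1 autM. Proof. by move=> f; exact: aut_ext. Qed.
Lemma autVM : left_inverse aut1 autV autM.
Proof. by move=> f; apply: aut_ext => x; exact: aut_invK. Qed.
Lemma autMV : right_inverse aut1 autV autM.
Proof. by move=> f; apply: aut_ext => x; exact: aut_funK. Qed.

HB.instance Definition _ := isGroup.Build automorphism autA aut1M autM1 autVM autMV.

Definition automorphism_group : groupType := automorphism.

End Polytope.

Section GroupPolytope.
Variables (G : groupType) (n : nat) (rho : 'I_n -> G).

(* With the shifted ranks, [face_stab k] is the subgroup generated by the
   rho_j, j <> k - 1; for k = 0 and k = n.+1 (the two improper faces) it is
   generated by all of them. *)
Definition face_stab (k : 'I_n.+2) : set G :=
  generated (rho @` [set j : 'I_n | j.+1 != k :> nat]).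

Definition faces : set ('I_n.+2 * set G) :=
  [set F | right_cosets (face_stab F.1) F.2].

Definition face_rank (F : faces) : nat := (val F).1.

Definition face_le (E F : faces) : Prop :=
  (face_rank E <= face_rank F)%N /\ (val E).2 `&` (val F).2 !=set0.

End GroupPolytope.

(* The polytope P is given by its group U = <tau_0, ..., tau_(n-1)>, with the
   central element alpha; its vertices are the right cosets of
   <tau_1, ..., tau_(n-1)>, on which U acts by right multiplication. *)
Section TwistedPower.
Variables (U : groupType) (n : nat) (tau : 'I_n -> U).
Variables (alpha : U) (alphaC : forall g, commute alpha g) (s : nat).

Definition vertex_stab : set U :=
  generated (tau @` [set j : 'I_n | j != 0%N :> nat]).

Definition vertex : choiceType := right_cosets vertex_stab.

Lemma right_coset_coset (H : set U) g h :
  right_coset (right_coset H g) h = right_coset H (g * h).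
Proof.
rewrite /right_coset image_comp; congr (_ @` _).
by apply/funext => x /=; rewrite mulgA.
Qed.

Lemma right_cosetsM (F : vertex) g :
  right_coset (val F) g \in right_cosets vertex_stab.
Proof.
apply/mem_set; have [h _ <-] := set_mem (valP F).
by exists (h * g) => //; rewrite right_coset_coset.
Qed.

Definition vertex_mul (F : vertex) (g : U) : vertex :=
  Sub (right_coset (val F) g) (right_cosetsM F g).

Lemma base_vertexP : right_coset vertex_stab 1 \in right_cosets vertex_stab.
Proof. by apply/mem_set; exists 1. Qed.

Definition base_vertex : vertex := Sub (right_coset vertex_stab 1) base_vertexP.

Definition vertex_matrix (F F' : vertex) : nat :=
  if F' == F then 1%N else if F' == vertex_mul F alpha then s else 2.

Definition vertex_group : groupType := coxeter vertex_matrix.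

Definition sigma (F : vertex) : vertex_group := cgen vertex_matrix F.

Lemma vertex_mulM F g h : vertex_mul F (g * h) = vertex_mul (vertex_mul F g) h.
Proof. by apply: val_inj; rewrite /= right_coset_coset. Qed.

Lemma vertex_mul1 F : vertex_mul F 1 = F.
Proof.
apply: val_inj; rewrite /= /right_coset -[RHS]image_id; congr (_ @` _).
by apply/funext => x; rewrite mulg1.
Qed.

Lemma vertex_mulI g : injective (vertex_mul^~ g).
Proof.
apply: (can_inj (g := vertex_mul^~ g^-1)) => F.
by rewrite -vertex_mulM mulgV vertex_mul1.
Qed.

Lemma vertex_matrixM F F' g :
  vertex_matrix (vertex_mul F g) (vertex_mul F' g) = vertex_matrix F F'.
Proof.
rewrite /vertex_matrix (inj_eq (@vertex_mulI g)) -vertex_mulM -alphaC.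
by rewrite vertex_mulM (inj_eq (@vertex_mulI g)).
Qed.

(* The action of U on [vertex_group] with sigma_F |-> sigma_(F g). *)
Definition vertex_act (w : vertex_group) (g : U) : vertex_group :=
  plift (fun F => sigma (vertex_mul F g)) w.

Lemma vertex_act_rel g r : coxeter_relators vertex_matrix r ->
  weval (fun F => sigma (vertex_mul F g)) r = 1.
Proof.
case=> F [F' ->]; rewrite weval_coxeter -(vertex_matrixM F F' g).
exact: cgen_rel.
Qed.

Lemma vertex_actM g : {morph vertex_act^~ g : u v / u * v}.
Proof. exact: pliftM (@vertex_act_rel g). Qed.

Lemma vertex_act_sigma F g : vertex_act (sigma F) g = sigma (vertex_mul F g).
Proof. exact: plift_gen (@vertex_act_rel g) F. Qed.

Lemma vertex_act1 w : vertex_act w 1 = w.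
Proof.
apply: (pmorph_ext (@vertex_actM 1) (g := id)) => // F.
by rewrite [LHS]vertex_act_sigma vertex_mul1.
Qed.

Lemma vertex_act_mul w g h :
  vertex_act w (g * h) = vertex_act (vertex_act w g) h.
Proof.
apply: (pmorph_ext (@vertex_actM _) (g := fun w => _ (_ w g) h)) => [u v|F].
  by rewrite !vertex_actM.
by rewrite !vertex_act_sigma vertex_mulM.
Qed.

Definition vertex_action : raction U vertex_group :=
  RAction vertex_actM vertex_act1 vertex_act_mul.

Definition twisted_group : groupType := semidirect vertex_action.

Definition twisted_rho (i : 'I_n.+1) : twisted_group :=
  if unlift ord0 i is Some j then SDPair vertex_action (tau j) 1
  else SDPair vertex_action 1 (sigma base_vertex).

End TwistedPower.

(* A derivation [ps] rewrites a word by applying, for each [(i, k)] in [ps],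
   the k-th rule of [rs] at position i. *)
Section Derivation.
Variables (G : groupType) (f : nat -> G) (rs : seq (seq nat * seq nat)).

Definition nval (w : seq nat) : G := foldr (fun i x => f i * x) 1 w.

Lemma nval_cat u v : nval (u ++ v) = nval u * nval v.
Proof. by elim: u => [|i u IH] /=; rewrite ?mul1g // IH mulgA. Qed.

Lemma nval_conj k w : nval (k :: rcons w k) = f k * (nval w * f k).
Proof. by rewrite -cats1 /= nval_cat /= mulg1. Qed.

Definition derive1 w (p : nat * nat) :=
  let: (l, r) := nth ([::], [::]) rs p.2 in
  if take (size l) (drop p.1 w) == l
  then take p.1 w ++ r ++ drop (size l) (drop p.1 w) else w.

Lemma derivation ps w : {in rs, forall lr, nval lr.1 = nval lr.2} ->
  nval (foldl derive1 w ps) = nval w.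
Proof.
move=> rsP; elim: ps w => //= -[i k] ps IH w; rewrite {}IH /derive1 /=.
have : nval (nth ([::], [::]) rs k).1 = nval (nth ([::], [::]) rs k).2.
  have [/(mem_nth ([::], [::]))/rsP //|/(nth_default _) -> //] := ltnP k (size rs).
case: (nth _ rs k) => l r /= lr; case: eqP => // e.
rewrite -[in RHS](cat_take_drop i w) -[in RHS](cat_take_drop (size l) (drop i w)).
by rewrite e !nval_cat lr.
Qed.

End Derivation.

Definition cox53 : groupType := string_coxeter [:: 5; 3].

Definition tau53 : 'I_3 -> cox53 := cgen (@string_matrix [:: 5; 3]).

Definition alpha53 : cox53 :=
  (tau53 (inord 0) * tau53 (inord 1) * tau53 (inord 2)) ^+ 5.

(* The derivations are sequences of braid moves, found by breadth-first
   search. *)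
Lemma coxeter53_central (G : groupType) (a b c : G) :
  a * a = 1 -> b * b = 1 -> c * c = 1 ->
  (a * b) ^+ 5 = 1 -> (b * c) ^+ 3 = 1 -> (a * c) ^+ 2 = 1 ->
  [/\ commute ((a * b * c) ^+ 5) a, commute ((a * b * c) ^+ 5) b &
      commute ((a * b * c) ^+ 5) c].
Proof.
move=> aa bb cc ab bc ac; set z := _ ^+ 5.
pose f := nth 1 [:: a; b; c].
pose w := flatten (nseq 5 [:: 0; 1; 2]%N).
pose rs : seq (seq nat * seq nat) :=
  [:: ([:: 0; 1; 0; 1; 0], [:: 1; 0; 1; 0; 1]);
      ([:: 1; 0; 1; 0; 1], [:: 0; 1; 0; 1; 0]);
      ([:: 1; 2; 1], [:: 2; 1; 2]); ([:: 2; 1; 2], [:: 1; 2; 1]);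
      ([:: 0; 2], [:: 2; 0]); ([:: 2; 0], [:: 0; 2]);
      ([:: 0; 0], [::]); ([:: 1; 1], [::]); ([:: 2; 2], [::])]%N.
have inv (x : G) : x * x = 1 -> x = x^-1.
  by move=> xx; apply: (mulgI x); rewrite mulgV.
have aV := inv a aa; have bV := inv b bb; have cV := inv c cc.
have ab5 : a * (b * (a * (b * a))) = b * (a * (b * (a * b))).
  apply: (mulIg (b * (a * (b * (a * b))))); move: ab.
  rewrite !expgSr expg0 mul1g -!mulgA => ->.
  by rewrite (mulgA b b) bb mul1g (mulgA a a) aa mul1g (mulgA b b) bb
    mul1g (mulgA a a) aa mul1g bb.
have bc3 : b * (c * b) = c * (b * c).
  apply: (mulIg (c * (b * c))); move: bc.
  rewrite !expgSr expg0 mul1g -!mulgA => ->.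
  by rewrite (mulgA c c) cc mul1g (mulgA b b) bb mul1g cc.
have ac2 : a * c = c * a by rewrite [LHS]inv // invgM -aV -cV.
have rsP : {in rs, forall lr, nval f lr.1 = nval f lr.2}.
  suff /allP h : all (fun lr => nval f lr.1 == nval f lr.2) rs.
    by move=> lr /h/eqP.
  by rewrite /= !mulg1 ab5 bc3 ac2 aa bb cc !eqxx.
have zE : nval f w = z by rewrite /z !expgS expg0 /= !mulg1 !mulgA.
have conj k ps : foldl (derive1 rs) (k :: rcons w k) ps = w ->
    f k * f k = 1 -> commute z (f k).
  move=> e kk; have := derivation ps (k :: rcons w k) rsP.
  rewrite e nval_conj zE => h.
  by rewrite /commute {2}h mulgA kk mul1g.
have zb : commute z b.
  apply: (conj 1%N [:: (14, 2); (13, 4); (3, 5); (4, 3); (0, 1); (4, 4);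
    (9, 5); (5, 0); (3, 2); (9, 2); (2, 4); (8, 4); (11, 8)]%N) => //.
have zc : commute z c.
  apply: (conj 2%N [:: (0, 5); (1, 3); (6, 5); (7, 3); (3, 1); (7, 4); (12, 5);
    (8, 0); (6, 2); (12, 2); (5, 4); (11, 4); (14, 8)]%N) => //.
split=> //; have -> : a = (a * b * c) * c * b.
  by rewrite -!mulgA (mulgA c c) cc mul1g bb mulg1.
by do 2![apply: commuteM => //]; apply/commute_sym/commuteX.
Qed.

Lemma cgen_generates (I : choiceType) (m : I -> I -> nat) (x : coxeter m) :
  (forall i, commute x (cgen m i)) -> forall g, commute x g.
Proof.
move=> xc g; rewrite -[g]reprK cls_weval; elim: (repr g) => [|[i b] w IH] /=.
  exact: commute1.
apply: commuteM IH; case: b; last exact: xc.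
exact/commuteV/xc.
Qed.

Lemma alpha53_central (g : cox53) : commute alpha53 g.
Proof.
have rel i j k : @string_matrix [:: 5; 3] i j = k ->
  (tau53 i * tau53 j) ^+ k = 1 by move=> <-; exact: cgen_rel.
have v k : (k < 3)%N -> @inord 2 k = k :> nat by exact: inordK.
have rel1 i : tau53 i * tau53 i = 1 by apply: (rel i i 1%N); rewrite /string_matrix eqxx.
have [||||||ha hb hc] := @coxeter53_central cox53 (tau53 (inord 0))
    (tau53 (inord 1)) (tau53 (inord 2)).
all: try by first [exact: rel1 | apply: rel; rewrite /string_matrix -val_eqE /= !v].
move: g; apply: (@cgen_generates _ (@string_matrix [:: 5; 3])) => i.
rewrite -[i]inord_val; by case: i => -[|[|[|//]]].
Qed.

Section TwistedDodecahedron.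
Variable s : nat.

Definition W53 : groupType := vertex_group tau53 alpha53 s.

(* The semidirect product of W53 by cox53 = [5,3]; see [twisted_group]. *)
Definition G53 : groupType := twisted_group tau53 alpha53_central s.

Definition rho53 : 'I_4 -> G53 := twisted_rho tau53 alpha53_central s.

Definition P53 := faces rho53.

Definition P53_le : P53 -> P53 -> Prop := @face_le G53 4 rho53.

Definition P53_rank : P53 -> nat := @face_rank G53 4 rho53.

End TwistedDodecahedron.

Definition cox453 : groupType := string_coxeter [:: 4; 5; 3].

Definition cox453_gen : 'I_4 -> cox453 := cgen (@string_matrix [:: 4; 5; 3]).

Definition extra_relators (s : nat) : set cox453 :=
  let r0 := cox453_gen (inord 0) in
  let beta :=
    cox453_gen (inord 1) * cox453_gen (inord 2) * cox453_gen (inord 3) in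
  [set (r0 * beta ^- i * r0 * beta ^+ i) ^+ 2 | i in [set i | (2 <= i <= 4)%N]]
  `|` [set (r0 * beta ^+ 5 * r0 * beta ^+ 5) ^+ s].

(* Main.v *)
From HB Require Import structures.
From mathcomp Require Import fingroup perm presentation extremal.
Require Import Defs.
From mathcomp Require Import all_boot monoid.
From mathcomp Require Import boolp classical_sets functions cardinality.

(** The proof has three independent ingredients.

    From string C-groups to polytopes.  The faces of the coset geometry that
    contain a fixed group element form a standard flag.  Removing a node
    disconnects the string diagram, so that the stabilizer of a face is the
    product of a factor acting below it and a commuting factor acting above it;
    this makes incidence transitive ([face_le_order]) and puts every chain in a
    standard flag ([chain_inc]).  The flags are therefore the standard flags,
    they correspond to the group elements, and left multiplication by a
    generator passes to an adjacent flag.  The intersection property then gives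
    the diamond condition, strong flag-connectedness, and the fact that a flag
    determines its group element, so that the group acts simply transitively on
    the flags and is the whole automorphism group ([string_C_regular],
    [string_C_automorphism]).

    The twisted power of a string C-group.  A standard subgroup of the
    semidirect product of W by U is itself a semidirect product: its part in W
    is generated by the sigma_F with F in the orbit of the base vertex under its
    part in U ([parabolic_twisted]).  Of the orbits belonging to I and J, one
    is contained in the orbit belonging to their intersection ([orbit_setI]), so
    the intersection property is inherited from U ([twisted_string_C]).

    The dodecahedron.  The group [5,3] is computed with a complete rewriting
    system, which bounds its order by 120, and with its action on the twenty
    vertices, which separates the 120 normal forms.  A normal form uses a letter
    only if the element needs it, whence the intersection property
    ([parabolic53P], [tau53_string_C]).  The ten antipodal pairs of vertices
    turn W into the tenth power of the dihedral group ([W53_dihedral]).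

    For the presentation, let q_0, ..., q_3 satisfy the relations of [4,5,3] and
    the extra relators.  Sending sigma_F to the conjugate of q_0 by any element
    that carries the base vertex to F is unambiguous, because q_0 commutes with
    q_2 and q_3.  Up to conjugation, a Coxeter relation of W involves the base
    vertex and its image under beta^i with i at most 5, because the stabilizer of
    the base vertex has one orbit of vertices at each distance ([vertex53_orbit]).
    These are the extra relations for i > 1, and the relation (q_0 q_1)^4 = 1
    for i = 1.  Hence the semidirect product maps to any group with such
    elements ([G53_universal]), in particular to the quotient of [4,5,3] by the
    normal closure of the relators, so that the kernel of the map from [4,5,3]
    to the semidirect product is no larger than that normal closure ([cox453_map_ker]). *)

Set Implicit Arguments.
Unset Strict Implicit.
Unset Printing Implicit Defensive.

Local Open Scope group_scope.
Local Open Scope classical_set_scope.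
Local Open Scope card_scope.

(** * Generated subgroups *)

Section Generated.
Variable G : groupType.
Implicit Types (A B H : set G) (x y : G).

Lemma generated_subgroup A : is_subgroup (generated A).
Proof.
split=> [H [[]] //|x y Ax Ay H HA|x Ax H HA].
  by case: (HA) => -[_ HM _] _; exact: HM (Ax H HA) (Ay H HA).
by case: (HA) => -[_ _ HV] _; exact: HV (Ax H HA).
Qed.

Lemma generated1 A : generated A 1.
Proof. by have [] := generated_subgroup A. Qed.

Lemma generatedM A x y : generated A x -> generated A y -> generated A (x * y).
Proof. by have [_ h _] := generated_subgroup A; apply: h. Qed.

Lemma generatedV A x : generated A x -> generated A x^-1.
Proof. by have [_ _ h] := generated_subgroup A; apply: h. Qed.

Lemma sub_generated A : A `<=` generated A.
Proof. exact: sub_gen_smallest. Qed.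

Lemma generated_sub A H : is_subgroup H -> A `<=` H -> generated A `<=` H.
Proof. exact: smallest_sub. Qed.

Lemma generatedS A B : A `<=` B -> generated A `<=` generated B.
Proof.
move=> AB; apply: generated_sub; first exact: generated_subgroup.
exact: subset_trans AB (@sub_generated B).
Qed.

Lemma generated0 : generated (@set0 G) = [set 1].
Proof.
apply/seteqP; split=> [|_ ->]; last exact: generated1.
apply: generated_sub => //; split=> // [x y -> ->|x ->]; first exact: mulg1.
exact: invg1.
Qed.

Lemma generated_ind A (P : G -> Prop) :
  (forall a, A a -> A a^-1) -> P 1 ->
  (forall x a, P x -> A a -> P (x * a)) -> forall x, generated A x -> P x.
Proof.
move=> AV P1 PM x Ax.
(* right multiplication by [y] and by [y^-1] are treated together, so that the
   set of good [y] is a subgroup *)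
suff : generated A `<=` [set y | forall z, (P z -> P (z * y)) /\
    (P z -> P (z * y^-1))].
  by move/(_ x Ax 1) => [/(_ P1)]; rewrite mul1g.
apply: generated_sub; last first.
  by move=> a Aa z; split=> Pz; apply: PM => //; apply: AV.
split=> [z|y y' hy hy' z|y hy z]; first by rewrite invg1 mulg1.
- split=> Pz; rewrite ?invgM mulgA.
    by apply: (hy' _).1; apply: (hy _).1.
  by apply: (hy _).2; apply: (hy' _).2.
- by rewrite invgK; split=> Pz; [apply: (hy _).2|apply: (hy _).1].
Qed.

(** Commutation passes from the generators to the subgroups that they generate,
    so that the products [a * b] multiply componentwise. *)
Lemma generatedU A B x :
  (forall a b, A a -> B b -> commute a b) -> generated (A `|` B) x ->
  exists a b, [/\ generated A a, generated B b, x = a * b & commute a b].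
Proof.
move=> AB.
have commAB a b : generated A a -> generated B b -> commute a b.
  move=> Aa; move: b.
  apply: (@generated_sub B [set b | commute a b]).
    split=> /= [|b b' cb cb'|b cb];
      [exact: commute1|exact: commuteM|exact: commuteV].
  move=> b Bb /=; apply/commute_sym.
  move: a Aa; apply: (@generated_sub A [set a | commute b a]).
    split=> /= [|a a' ca ca'|a ca];
      [exact: commute1|exact: commuteM|exact: commuteV].
  by move=> a Aa /=; apply/commute_sym/AB.
move: x; apply: (@generated_sub _ [set x | exists a b,
    [/\ generated A a, generated B b, x = a * b & commute a b]]).
  split=> /= [|x y|x].
  - exists 1, 1; split; rewrite ?mulg1 //; exact: generated1.
  - move=> [a [b [Aa Bb -> ab]]] [a' [b' [Aa' Bb' -> ab']]].
    exists (a * a'), (b * b').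
    split; try exact: generatedM.
      by rewrite -!mulgA; congr (_ * _); rewrite !mulgA (commAB a' b).
    by apply: commAB; apply: generatedM.
  - move=> [a [b [Aa Bb -> ab]]]; exists a^-1, b^-1.
    split; try exact: generatedV.
      by rewrite ab invgM.
    by apply: commAB; apply: generatedV.
move=> x [Ax|Bx].
  exists x, 1; split; rewrite ?mulg1 //;
    [exact: sub_generated|exact: generated1|exact: commute1].
exists 1, x; split; rewrite ?mul1g //; first exact: generated1.
  exact: sub_generated.
exact/commute_sym/commute1.
Qed.

Lemma right_cosetP H g x : right_coset H g x <-> H (x * g^-1).
Proof.
split=> [[h Hh <-]|Hx]; first by rewrite mulgK.
by exists (x * g^-1) => //; rewrite mulgVK.
Qed.

Lemma eq_right_coset H g h : is_subgroup H ->
  right_coset H g = right_coset H h <-> H (h * g^-1).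
Proof.
case=> H1 HM HV; split=> [gh|Hgh].
  by apply/right_cosetP; rewrite gh; apply/right_cosetP; rewrite mulgV.
apply/seteqP; split=> x /right_cosetP Hx; apply/right_cosetP.
  have -> : x * h^-1 = (x * g^-1) * (h * g^-1)^-1.
    by rewrite invgM invgK mulgA mulgVK.
  by apply: HM => //; apply: HV.
have -> : x * g^-1 = (x * h^-1) * (h * g^-1) by rewrite mulgA mulgVK.
exact: HM.
Qed.

End Generated.

Lemma invol_inv (G : groupType) (x : G) : x * x = 1 -> x^-1 = x.
Proof. by move=> xx; apply: (mulgI x); rewrite mulgV. Qed.

(** * String C-groups *)

Section StringC.
Variables (G : groupType) (n : nat) (rho : 'I_n -> G).
Hypothesis sC : string_C_group rho.

Definition parabolic (I : set 'I_n) : set G := generated (rho @` I).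

Lemma rho_invol i : rho i * rho i = 1.
Proof. by case: sC => -[_ /(_ i)[_ + _] _] _; rewrite expgS expg1. Qed.

Lemma rhoV i : (rho i)^-1 = rho i.
Proof. exact/invol_inv/rho_invol. Qed.

Lemma rho_neq1 i : rho i <> 1.
Proof. by case: sC => -[_ /(_ i)[_ _ h] _] _ r1; have := h 1%N isT r1. Qed.

Lemma rho_commute (i j : 'I_n) : (i.+2 <= j)%N || (j.+2 <= i)%N ->
  commute (rho i) (rho j).
Proof.
case: sC => _ h /h; rewrite expgS expg1 => /invol_inv.
by rewrite invgM !rhoV.
Qed.

Lemma parabolicT x : parabolic setT x.
Proof. by case: sC => -[h _ _] _; rewrite /parabolic h. Qed.

Lemma parabolicI I J : parabolic (I `&` J) = parabolic I `&` parabolic J.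
Proof. by case: sC => -[_ _ h] _; rewrite /parabolic h. Qed.

Lemma parabolicS I J : I `<=` J -> parabolic I `<=` parabolic J.
Proof. by move=> IJ; apply: generatedS; exact: image_subset. Qed.

Lemma parabolic_gen (I : set 'I_n) i : I i -> parabolic I (rho i).
Proof. by move=> Ii; apply: sub_generated; exists i. Qed.

Lemma parabolic_ind I (P : G -> Prop) : P 1 ->
  (forall x i, P x -> I i -> P (x * rho i)) ->
  forall x, parabolic I x -> P x.
Proof.
move=> P1 PM; apply: generated_ind => // [_ [i Ii <-]|x _ Px [i Ii <-]].
  by rewrite rhoV; exists i.
exact: PM.
Qed.

Lemma parabolic1 i x : parabolic [set i] x -> x = 1 \/ x = rho i.
Proof.
move: x; apply: parabolic_ind => [|x _ [->|->] ->]; first by left.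
  by right; rewrite mul1g.
by left; exact: rho_invol.
Qed.

(** Removing a node disconnects the string diagram, and generators on different
    sides of the missing node commute. *)
Lemma parabolic_split (I : set 'I_n) (j : 'I_n) x : ~ I j -> parabolic I x ->
  exists a b, [/\ parabolic (I `&` [set i | (i < j)%N]) a,
    parabolic (I `&` [set i | (j < i)%N]) b, x = a * b & commute a b].
Proof.
move=> Ij Ix.
have IE : I = (I `&` [set i | (i < j)%N]) `|` (I `&` [set i | (j < i)%N]).
  apply/seteqP; split=> [i Ii|i [[]|[]] //].
  have [ij|ji|/val_inj ij] := ltngtP i j; [by left|by right|].
  by case: Ij; rewrite -ij.
have : generated (rho @` (I `&` [set i | (i < j)%N]) `|`
                  rho @` (I `&` [set i | (j < i)%N])) x.
  by rewrite -image_setU -IE.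
apply: generatedU => _ _ [i [_ /= ij] <-] [k [_ /= jk] <-].
by apply: rho_commute; rewrite (leq_trans _ jk).
Qed.

Lemma parabolic_bigcap m (I : 'I_m -> set 'I_n) x :
  (forall k, parabolic (I k) x) -> parabolic [set j | forall k, I k j] x.
Proof.
elim: m I => [|m IH] I Ix.
  by apply: parabolicS (parabolicT x) => j _ [].
have := conj (Ix ord0) (IH (fun k => I (lift ord0 k)) (fun k => Ix _)).
rewrite -[_ /\ _]/((_ `&` _) x) -parabolicI; apply: parabolicS => j [I0 IS] k.
by case: (unliftP ord0 k) => [k' ->|->].
Qed.

(** * The coset geometry of a string C-group *)

Local Notation stab := (face_stab rho).
Local Notation le := (@face_le G n rho).

Definition node_neq (k : 'I_n.+2) : set 'I_n := [set j | j.+1 != k :> nat].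

Lemma stab_subgroup k : is_subgroup (stab k).
Proof. exact: generated_subgroup. Qed.

Lemma face_proof k g :
  (k, right_coset (stab k) g) \in faces rho.
Proof. by apply/mem_set; exists g. Qed.

Definition face k g : faces rho := SigSub (face_proof k g).

Definition inc (F : faces rho) g := (val F).2 g.

Lemma inc_face k g h : inc (face k g) h <-> stab k (h * g^-1).
Proof. exact: right_cosetP. Qed.

Lemma inc_face_id k g : inc (face k g) g.
Proof. by apply/inc_face; rewrite mulgV; exact: generated1. Qed.

Lemma eq_face k g h : face k g = face k h <-> stab k (h * g^-1).
Proof.
rewrite -(eq_right_coset g h (stab_subgroup k)).
by split=> [[//]|e]; apply: val_inj; rewrite /= e.
Qed.

Lemma incE F g : inc F g <-> F = face (val F).1 g.
Proof.
split=> [|->]; last exact: inc_face_id.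
case: F => -[k X] /=; rewrite /inc /= => FP; have /set_mem [h _ /= eX] := FP.
subst X => /right_cosetP kgh; apply: val_inj => /=; congr pair.
by apply/eq_right_coset => //; exact: stab_subgroup.
Qed.

Lemma inc_ex F : exists g, inc F g.
Proof.
have /set_mem [g _ gF] := valP F; exists g.
by rewrite /inc -gF; apply/right_cosetP; rewrite mulgV; exact: generated1.
Qed.

Lemma face_rank_inj E F g : inc E g -> inc F g ->
  face_rank E = face_rank F -> E = F.
Proof. by move=> /incE Eg /incE Fg /val_inj EF; rewrite Eg Fg EF. Qed.

Lemma inc0 F g : face_rank F = 0%N -> inc F g.
Proof.
have [h /incE ->] := inc_ex F; move=> F0; apply/inc_face.
apply: parabolicS (parabolicT _) => j _ /=.
by move: F0; rewrite /face_rank /= => ->.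
Qed.

Lemma le_eq_rank E F : le E F -> face_rank E = face_rank F -> E = F.
Proof. by move=> [_ [g [Eg Fg]]]; apply: (@face_rank_inj E F g). Qed.

(** The inductive step towards a common element of all faces of a chain: [y]
    replaces [g] without leaving the faces below [E].  Take [x] in both cosets
    and write [g = a b x] with [a b] in the stabilizer of [E], [a] below its node
    and [b] above it.  Then [y = a x] works: [a] stabilizes [F], which is of
    larger rank, and [y = b^-1 g] since [a] and [b] commute, while [b] stabilizes
    the faces of rank at most that of [E]. *)
Lemma inc_extend E F g : le E F -> inc E g ->
  exists2 y, inc F y &
    forall D, (face_rank D <= face_rank E)%N -> inc D g -> inc D y.
Proof.
move=> EF Eg; have [/(le_eq_rank EF) <-|neq] := eqVneq (face_rank E) (face_rank F).
  by exists g.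
case: (EF) => ler [x [Ex Fx]].
have {neq} ltr : (face_rank E < face_rank F)%N by rewrite ltn_neqAle neq.
case E0: (face_rank E) => [|i].
  by exists x => // D; rewrite leqn0 => /eqP D0 _; apply: inc0.
have iltn : (i < n)%N.
  by move: (leq_trans ltr (ltn_ord (val F).1 : face_rank F <= n.+1)%N); rewrite E0.
pose j := Ordinal iltn.
have := Eg; rewrite {1}(iffLR (incE E x) Ex) => /inc_face.
case/(@parabolic_split _ j) => [/=|a [b [aP bP ab abC]]].
  by apply/negP; rewrite negbK -E0.
exists (a * x).
  rewrite (iffLR (incE F x) Fx); apply/inc_face; rewrite mulgK.
  apply: parabolicS aP => k [_ /= kj]; rewrite -[X in _ != X]/(face_rank F).
  by rewrite ltn_eqF // (leq_ltn_trans _ ltr) // E0 ltnS ltnW.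
move=> D Di; rewrite incE => Dg; rewrite Dg; apply/inc_face.
have -> : a * x * g^-1 = b^-1.
  have -> : g = b * (a * x) by rewrite mulgA -abC -ab mulgVK.
  by rewrite invgM mulgA mulgV mul1g.
apply: generatedV; apply: parabolicS bP => k [_ /= jk].
rewrite -[X in _ != X]/(face_rank D).
by rewrite gtn_eqF // ltnS (leq_trans Di).
Qed.

(** By induction on the rank of the faces; at a face [F] of rank [k], a common
    element of the faces of smaller rank is moved into [F]. *)
Lemma chain_inc C : chain le C -> exists g, forall F, C F -> inc F g.
Proof.
move=> Cch.
suff H k : exists g, forall F, C F -> (face_rank F < k)%N -> inc F g.
  by have [g Hg] := H n.+2; exists g => F CF; apply: Hg => //; apply: ltn_ord.
elim: k => [|k [g Hg]]; first by exists 1.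
have [[F [CF Fk]]|noF] := pselect (exists F, C F /\ face_rank F = k); last first.
  exists g => F CF; rewrite ltnS leq_eqVlt => /orP[/eqP Fk|]; last exact: Hg.
  by case: noF; exists F.
have leF E : C E -> (face_rank E <= k)%N -> le E F.
  move=> CE Ek; have [//|FE] := Cch E F CE CF.
  suff -> : F = E by split=> //; have [h] := inc_ex E; exists h.
  by apply: le_eq_rank => //; apply/eqP; rewrite eqn_leq FE.1 Fk.
have {}H m : (m <= k)%N -> exists2 y, inc F y &
    forall E, C E -> (face_rank E < m)%N -> inc E y.
  elim: m => [|m IHm] mk; first by have [y Fy] := inc_ex F; exists y.
  have [[E [CE Em]]|noE] := pselect (exists E, C E /\ face_rank E = m); last first.
    have [y Fy Hy] := IHm (ltnW mk); exists y => // E CE.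
    rewrite ltnS leq_eqVlt => /orP[/eqP Em|]; last exact: Hy.
    by case: noE; exists E.
  have Ek : (face_rank E < k)%N by rewrite Em.
  have [y Fy Hy] := inc_extend (leF E CE (ltnW Ek)) (Hg E CE Ek).
  exists y => // D CD; rewrite ltnS -Em => Dm; apply: Hy => //.
  by apply: Hg => //; apply: leq_ltn_trans Ek.
have [y Fy Hy] := H k (leqnn k); exists y => E CE.
rewrite ltnS leq_eqVlt => /orP[/eqP Ek|]; last exact: Hy.
by rewrite (le_eq_rank (leF E CE _)) // Ek // Fk.
Qed.

Definition std_flag g : set (faces rho) := [set F | inc F g].

Lemma std_flagE g : std_flag g = range (face^~ g).
Proof.
apply/seteqP; split=> [F /incE ->|_ [k _ <-]]; first by eexists.
exact: inc_face_id.
Qed.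

Lemma std_flag_chain g : chain le (std_flag g).
Proof.
by move=> E F Eg Fg; have /orP[] := leq_total (face_rank E) (face_rank F);
  [left|right]; split=> //; exists g.
Qed.

Lemma std_flag_sub g h : std_flag g `<=` std_flag h -> std_flag g = std_flag h.
Proof.
move=> gh; apply/seteqP; split=> // F Fh.
have := gh _ (inc_face_id (val F).1 g) => /= gFh.
by rewrite (face_rank_inj Fh gFh erefl); exact: inc_face_id.
Qed.

Lemma flagP C : flag le C <-> exists g, C = std_flag g.
Proof.
split=> [[Cch Cmax]|[g ->]].
  have [g Cg] := chain_inc Cch; exists g.
  by apply/esym/Cmax => //; exact: std_flag_chain.
split=> [|D Dch gD]; first exact: std_flag_chain.
have [h Dh] := chain_inc Dch; apply/seteqP; split=> //.
by rewrite (std_flag_sub (subset_trans gD Dh)).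
Qed.

Lemma flag_std_flag g : flag le (std_flag g).
Proof. by apply/flagP; exists g. Qed.

(** The intersection property for the stabilizers of all the faces of a standard
    flag that are not moved by the [rho j], [j] in [J]. *)
Lemma stab_bigcap (J : set 'I_n) x :
  (forall k : 'I_n.+2, (forall j, J j -> k != j.+1 :> nat) -> stab k x) ->
  parabolic J x.
Proof.
move=> Jx.
pose I (k : 'I_n.+2) : set 'I_n :=
  [set i | (forall j, J j -> k != j.+1 :> nat) -> node_neq k i].
suff /(@parabolic_bigcap _ I) : forall k, parabolic (I k) x.
  apply: parabolicS => i Ii; apply: contrapT => Ji.
  have := Ii (lift ord0 (widen_ord (leqnSn n) i)).
  rewrite /I /node_neq /= /bump add1n eqxx => h; suff : false by []; apply: h.
  move=> j Jj; rewrite eqSS; apply/eqP => /val_inj ij.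
  by apply: Ji; rewrite ij.
move=> k; have [/Jx|nk] := pselect (forall j, J j -> k != j.+1 :> nat).
  by apply: parabolicS => j kj _.
by apply: parabolicS (parabolicT x) => j _ /nk.
Qed.

Lemma std_flag_inj g h : std_flag g = std_flag h -> g = h.
Proof.
move=> gh; suff : parabolic set0 (h * g^-1).
  rewrite /parabolic image_set0 generated0 => /= e.
  by rewrite -[h](mulgVK g) e mul1g.
apply: stab_bigcap => k _; apply/inc_face.
by rewrite -[inc _ _]/(std_flag h _) -gh; exact: inc_face_id.
Qed.

Lemma stab_rho (k : 'I_n.+2) j : stab k (rho j) <-> k != j.+1 :> nat.
Proof.
split=> [kj|kj]; last by apply: parabolic_gen => /=; rewrite eq_sym.
apply/eqP => ekj; apply: (@rho_neq1 j).
have : (parabolic [set j] `&` parabolic (node_neq k)) (rho j).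
  by split=> //; exact: parabolic_gen.
rewrite -parabolicI (_ : _ `&` _ = set0) ?[parabolic set0]/parabolic.
  by rewrite image_set0 generated0.
by apply/seteqP; split=> // i [-> ]; rewrite /node_neq /= ekj eqxx.
Qed.

Lemma face_rho k j g : face k (rho j * g) = face k g <-> k != j.+1 :> nat.
Proof. by rewrite eq_face invgM rhoV mulgA mulgV mul1g; exact: stab_rho. Qed.

Lemma inc_rho F (j : 'I_n) g : inc F g -> face_rank F != j.+1 -> inc F (rho j * g).
Proof.
by move=> /incE Fg Fj; apply/incE; rewrite {1}Fg; apply/esym/face_rho.
Qed.

Lemma inc_rhoP F (j : 'I_n) g : inc F g -> inc F (rho j * g) -> face_rank F != j.+1.
Proof.
move=> /incE Fg /incE Fj; apply/(@face_rho (val F).1 j g).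
by rewrite -Fj -Fg.
Qed.

Lemma adjacent_rho (j : 'I_n) g : adjacent (std_flag g) (std_flag (rho j * g)).
Proof.
have D h : std_flag (rho j * h) `\` std_flag h =
    [set face (lift ord0 (widen_ord (leqnSn n) j)) (rho j * h)].
  apply/seteqP; split=> [F [Fj Fh]|_ ->].
    apply: etrans (iffLR (incE F _) Fj) _; congr face.
    apply: val_inj; rewrite /= /bump add1n; apply/eqP/negPn/negP => neq.
    apply: Fh; rewrite /std_flag /= -[h](mulKg (rho j)) rhoV.
    exact: inc_rho.
  split; first exact: inc_face_id.
  move=> h'; have := inc_rhoP h' (inc_face_id _ _).
  by rewrite /face_rank /= /bump add1n eqxx.
split; last by rewrite D; exact: card_set1.
have -> : std_flag g = std_flag (rho j * (rho j * g)).
  by rewrite mulgA rho_invol mul1g.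
rewrite D; exact: card_set1.
Qed.

Lemma face_rank_lt E F : slt le E F -> (face_rank E < face_rank F)%N.
Proof.
move=> [EF neq]; rewrite ltn_neqAle EF.1 andbT.
by apply/eqP => /(le_eq_rank EF).
Qed.

Lemma lt_face (i j : 'I_n.+2) g : (i < j)%N -> slt le (face i g) (face j g).
Proof.
move=> ij; split; first by split; [exact: ltnW|exists g; split; exact: inc_face_id].
by move/(congr1 (@face_rank _ _ _)); apply/eqP; rewrite ltn_eqF.
Qed.

Lemma face_le_order : [/\ forall F, le F F,
  forall E F, le E F -> le F E -> E = F &
  forall D E F, le D E -> le E F -> le D F].
Proof.
split=> [F|E F EF FE|D E F DE EF].
- by split=> //; have [g Fg] := inc_ex F; exists g.
- by apply: le_eq_rank => //; apply/eqP; rewrite eqn_leq EF.1 FE.1.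
have [_ [g [Dg Eg]]] := DE; have [y Fy Ey] := inc_extend EF Eg.
split; first exact: leq_trans DE.1 EF.1.
by exists y; split=> //; apply: Ey => //; exact: DE.1.
Qed.

(** A face between two faces of ranks [j] and [j.+2] contains some [h = u g],
    where [g] lies in the two outer faces and [u] in both their stabilizers.
    There [rho_j] commutes with the other generators, and these stabilize the
    middle rank, so that only [u = 1] and [u = rho_j] matter. *)
Lemma face_diamond E F : le E F -> face_rank F = (face_rank E).+2 ->
  [set D | slt le E D /\ slt le D F] #= `I_2.
Proof.
move=> EF rF; have [_ [g [Eg Fg]]] := EF.
have jn : (face_rank E < n)%N.
  by have := ltn_ord (val F).1; rewrite -[nat_of_ord _]/(face_rank F) rF !ltnS.
pose j := Ordinal jn; pose k := lift ord0 (widen_ord (leqnSn n) j).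
have kE : k = (face_rank E).+1 :> nat by rewrite /= /bump add1n.
suff -> : [set D | slt le E D /\ slt le D F] =
    [set face k g; face k (rho j * g)].
  apply/eq_cardSP; exists (face k g); first by left.
  rewrite (_ : _ `\` _ = [set face k (rho j * g)]); first exact: card_set1.
  apply/seteqP; split=> [D [[|] //]|D ->]; split; first by right.
  by move=> /face_rho; rewrite kE eqxx.
have between h : inc E h -> inc F h -> slt le E (face k h) /\ slt le (face k h) F.
  move=> /incE -> /incE ->; split; apply: lt_face; rewrite kE //.
  by rewrite -[nat_of_ord _]/(face_rank F) rF.
apply/seteqP; split=> [D [ED DF]|D [|] ->]; last 2 first.
- exact: between.
- apply: between; apply: inc_rho => //; first by rewrite ltn_eqF.
  by rewrite rF gtn_eqF.
have Dk : (val D).1 = k.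
  apply: val_inj; apply/eqP; rewrite /= [X in _ == X]kE eqn_leq.
  rewrite (face_rank_lt ED) andbT -ltnS; move: (face_rank_lt DF).
  by rewrite rF.
have [|h hC] := @chain_inc [set E; D; F].
  have [refl _ _] := face_le_order; have := (ED.1, DF.1).
  by move=> [leED leDF] X Y [[->|->]|->] [[->|->]|->]; auto.
have /incE Dh : inc D h by apply: hC; left; right.
have : parabolic (node_neq (val E).1 `&` node_neq (val F).1) (h * g^-1).
  rewrite parabolicI; split; apply/inc_face.
    by rewrite -(iffLR (incE E g) Eg); apply: hC; left; left.
  by rewrite -(iffLR (incE F g) Fg); apply: hC; right.
set A := _ `&` _; have Aj : A = (A `\ j) `|` [set j].
  apply/seteqP; split=> [i Ai|i [[]//|->]].
    by have [->|ij] := eqVneq i j; [right|left; split=> //; apply/eqP].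
  split; rewrite /node_neq /= -[nat_of_ord (val _).1]/(face_rank _) ?rF.
    by rewrite gtn_eqF.
  by rewrite ltn_eqF.
rewrite Aj /parabolic image_setU => /generatedU[].
  move=> _ _ [i [[iE iF] /eqP ij] <-] [_ -> <-]; apply: rho_commute.
  move: ij iE iF; rewrite -val_eqE /node_neq /=.
  rewrite -[nat_of_ord (val E).1]/(face_rank E).
  rewrite -[nat_of_ord (val F).1]/(face_rank F) rF eqSS.
  rewrite neq_ltn => /orP[] ij iE iF; apply/orP; [left|right].
    by rewrite ltn_neqAle iE.
  by rewrite ltn_neqAle eq_sym iF.
move=> a [b [aP /parabolic1 bP ab _]].
have {Dh} : D = face k (b * g).
  rewrite Dh Dk; apply/esym/eq_face; rewrite invgM mulgA ab mulgK.
  apply: parabolicS aP => i [_ /eqP ij] /=.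
  by move: ij; rewrite -val_eqE /= /bump add1n eqSS.
by case: bP => -> ->; [left; rewrite mul1g|right].
Qed.

(** A word for [u] is a gallery of flags, in which each letter changes one face;
    the letters in [J] change no face of [A]. *)
Lemma flag_connected_rho (A : set (faces rho)) (J : set 'I_n) u g :
  (forall F j, A F -> J j -> face_rank F != j.+1) ->
  parabolic J u -> A `<=` std_flag g ->
  flag_connected le A (std_flag g) (std_flag (u * g)).
Proof.
move=> AJ Ju; move: u Ju g.
apply: parabolic_ind => [|u j IH Jj] g Ag.
  by rewrite mul1g; apply: flag_connected0 => //; exact: flag_std_flag.
apply: (flag_connectedS _ Ag (adjacent_rho j g)); first exact: flag_std_flag.
rewrite -mulgA; apply: IH => F AF; apply: inc_rho; first exact: Ag.
exact: AJ.
Qed.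

Lemma strong_flag_connected C D : flag le C -> flag le D ->
  flag_connected le (C `&` D) C D.
Proof.
move=> /flagP[g ->] /flagP[h ->]; rewrite -{2}[h](mulgVK g).
pose J : set 'I_n :=
  [set j | ~ stab (lift ord0 (widen_ord (leqnSn n) j)) (h * g^-1)].
apply: (@flag_connected_rho _ J); last exact: subIsetl.
  move=> F j [Fg Fh] Jj; apply/eqP => Fj; apply: Jj.
  have <- : (val F).1 = lift ord0 (widen_ord (leqnSn n) j).
    by apply: val_inj; rewrite /= [LHS]Fj /bump add1n.
  by apply/inc_face; rewrite -(iffLR (incE F g) Fg).
apply: stab_bigcap => k kJ; apply: contrapT => nk.
have [k0|k0] := posnP k.
  by apply: nk; apply: parabolicS (parabolicT _) => j _ /=; rewrite k0.
have [kn|kn] := ltnP k.-1 n; last first.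
  apply: nk; apply: parabolicS (parabolicT _) => j _ /=.
  by rewrite neq_ltn -(prednK k0) ltnS (leq_trans (ltn_ord j) kn).
have kE : k = lift ord0 (widen_ord (leqnSn n) (Ordinal kn)).
  by apply: val_inj; rewrite /= /bump add1n prednK.
have /kJ : J (Ordinal kn) by rewrite /J /= -kE.
by rewrite /= prednK // eqxx.
Qed.

Lemma string_C_polytope : polytope le n (@face_rank G n rho).
Proof.
split.
- exact: face_le_order.
- split; [exists (face ord0 1)|exists (face ord_max 1)] => F.
    split=> //; have [g Fg] := inc_ex F.
    by exists g; split=> //; exact: (@inc0 (face ord0 1)).
  split; first exact: leq_ord.
  have [g Fg] := inc_ex F; exists g; split=> //; apply/inc_face.
  apply: parabolicS (parabolicT _) => j _ /=.
  by rewrite ltn_eqF // ltnS.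
- split=> [F|E F|C /flagP[g ->]]; [exact: leq_ord|exact: face_rank_lt|].
  rewrite std_flagE; apply: (card_eq_trans (inj_card_eq _)).
    by move=> i j _ _ /(congr1 (@face_rank _ _ _))/val_inj.
  exact/card_esym/card_II.
- exact: strong_flag_connected.
- exact: face_diamond.
Qed.

(** * Automorphisms of the coset geometry *)

Lemma translate_proof x (F : faces rho) :
  ((val F).1, right_coset (val F).2 x) \in faces rho.
Proof.
apply/mem_set; have /set_mem [g _ <-] := valP F.
by exists (g * x) => //; rewrite right_coset_coset.
Qed.

Definition translate_face x F : faces rho := SigSub (translate_proof x F).

Lemma translate_faceE x k g : translate_face x (face k g) = face k (g * x).
Proof. by apply: val_inj; rewrite /= right_coset_coset. Qed.

Lemma faceP F : exists k g, F = face k g.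
Proof. by have [g /incE Fg] := inc_ex F; exists (val F).1, g. Qed.

Lemma translate_faceM x y F :
  translate_face (x * y) F = translate_face y (translate_face x F).
Proof. by have [k [g ->]] := faceP F; rewrite !translate_faceE mulgA. Qed.

Lemma translate_face1 F : translate_face 1 F = F.
Proof. by have [k [g ->]] := faceP F; rewrite translate_faceE mulg1. Qed.

Lemma translate_le x E F : le E F -> le (translate_face x E) (translate_face x F).
Proof.
move=> [r [g [Eg Fg]]]; split=> //; exists (g * x).
by split; apply/right_cosetP; rewrite mulgK.
Qed.

Lemma translate_faceK x :
  cancel (translate_face x) (translate_face x^-1).
Proof. by move=> F; rewrite -translate_faceM mulgV translate_face1. Qed.

Lemma translate_faceVK x :
  cancel (translate_face x^-1) (translate_face x).
Proof. by move=> F; rewrite -translate_faceM mulVg translate_face1. Qed.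

Lemma translate_face_le x E F :
  le (translate_face x E) (translate_face x F) <-> le E F.
Proof.
split; last exact: translate_le.
by move=> /(@translate_le x^-1); rewrite !translate_faceK.
Qed.

Definition translation x : automorphism_group le :=
  Automorphism (translate_faceK x) (translate_faceVK x) (@translate_face_le x).

Lemma translationM : {morph translation : x y / x * y}.
Proof. by move=> x y; apply: aut_ext => F; exact: translate_faceM. Qed.

Lemma translation_flag x g : translation x @` std_flag g = std_flag (g * x).
Proof.
rewrite !std_flagE image_comp; congr (_ @` _).
by apply/funext => k; exact: translate_faceE.
Qed.

Lemma string_C_regular : regular_polytope le n (@face_rank G n rho).
Proof.
split; first exact: string_C_polytope.
move=> C D /flagP[g ->] /flagP[h ->]; exists (translation (g^-1 * h)).
by rewrite translation_flag mulVKg.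
Qed.

Lemma incr_ord_id m (f : nat -> nat) :
  (forall i j, (i < j < m)%N -> (f i < f j)%N) ->
  (forall i, (i < m)%N -> (f i < m)%N) ->
  forall i, (i < m)%N -> f i = i.
Proof.
move=> fS fm i im; apply/eqP; rewrite eqn_leq; apply/andP; split; last first.
  elim: i im => // i IH im; apply: leq_ltn_trans (IH (ltnW im)) _.
  by apply: fS; rewrite ltnSn.
have {im} [d md] : exists d, m = (i + d).+1.
  by exists (m - i.+1)%N; rewrite -addSn subnKC.
elim: d i md => [|d IH] i md.
  by rewrite -ltnS -[i in X in (_ <= X)%N]addn0 -md; apply: fm; rewrite md addn0.
rewrite -ltnS; apply: leq_trans (IH i.+1 _); last by rewrite md addnS.
by apply: fS; rewrite md ltnSn /= ltnS addnS ltnS leq_addr.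
Qed.

Lemma aut_inj (f : automorphism_group le) : injective f.
Proof. exact: can_inj (@aut_funK _ _ f). Qed.

Lemma aut_slt (f : automorphism_group le) E F :
  slt le E F -> slt le (f E) (f F).
Proof. by move=> [EF neq]; split; [exact/aut_le|move=> /aut_inj]. Qed.

(** On a flag, an automorphism induces a strictly increasing map between the
    ranks [0, ..., n.+1]. *)
Lemma aut_rank (f : automorphism_group le) F : face_rank (f F) = face_rank F.
Proof.
have [k [g ->]] := faceP F.
have := @incr_ord_id n.+2 (fun i => face_rank (f (face (inord i) g))).
move=> /(_ _ _ k (ltn_ord k)); rewrite inord_val; apply=> [i j /andP[ij jn]|i _].
  apply: face_rank_lt; apply: aut_slt; apply: lt_face.
  by rewrite !inordK // (ltn_trans ij).
exact: ltn_ord.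
Qed.

Lemma aut_flag (f : automorphism_group le) C : flag le C -> flag le (f @` C).
Proof.
move=> [Cch Cmax]; split=> [_ _ [E CE <-] [F CF <-]|D Dch fCD].
  by have [] := Cch E F CE CF; [left|right]; exact/aut_le.
have fK : f @` (f @^-1` D) = D.
  apply/seteqP; split=> [_ [F ? <-]//|F DF].
  by exists (aut_inv f F); rewrite /preimage /= aut_invK.
rewrite -fK; congr (_ @` _); apply: Cmax => [E F fE fF|F CF].
  by have [] := Dch _ _ fE fF => /aut_le; [left|right].
by apply: fCD; exists F.
Qed.

Lemma aut_std_flag (f : automorphism_group le) g :
  exists h, forall k, f (face k g) = face k h.
Proof.
have /flagP[h fh] := aut_flag f (flag_std_flag g); exists h => k.
have : std_flag h (f (face k g)).
  by rewrite -fh; exists (face k g) => //; exact: inc_face_id.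
move=> /incE ->; congr face; apply: val_inj.
exact: aut_rank f (face k g).
Qed.

(** An automorphism that agrees with a translation on one flag agrees with it
    on the adjacent flags, as each face of a flag can be changed in only one
    way; so it agrees with it on all flags. *)
Lemma translation_surj (f : automorphism_group le) : exists x, translation x = f.
Proof.
have [x fx] := aut_std_flag f 1; exists x; apply: aut_ext => F.
suff H g k : f (face k g^-1) = face k (g^-1 * x).
  have [k [g ->]] := faceP F; rewrite -[g]invgK H; exact: translate_faceE.
move: g (parabolicT g) k; apply: parabolic_ind => [|g i IH _] k.
  by rewrite invg1 mul1g.
rewrite invgM rhoV; set y := g^-1 in IH *.
have [h fh] := aut_std_flag f (rho i * y).
suff -> : rho i * y * x = h by exact: fh.
have hP : parabolic [set i] (h * (y * x)^-1).
  apply: stab_bigcap => {}k ki; apply/eq_face; rewrite -IH -fh.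
  by congr (f _); apply/esym/face_rho; exact: ki.
have [hy|hy] := parabolic1 hP; last by rewrite -mulgA -hy mulgVK.
have {hy} hE : h = y * x by rewrite -[h](mulgVK (y * x)) hy mul1g.
pose m : 'I_n.+2 := lift ord0 (widen_ord (leqnSn n) i).
have /aut_inj/face_rho : f (face m (rho i * y)) = f (face m y).
  by rewrite fh IH hE.
by rewrite /= /bump add1n eqxx.
Qed.

Lemma translation_inj : injective translation.
Proof.
move=> x y xy; apply: std_flag_inj.
by rewrite -[x]mul1g -[y]mul1g -!translation_flag xy.
Qed.

End StringC.

(** * Isomorphisms *)

Lemma isomorphic_morph (G H : groupType) (f : G -> H) :
  {morph f : x y / x * y} -> bijective f -> isomorphic G H.
Proof.
move=> fM fbij; pose m := isMultiplicative.Build G H f fM.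
by exists (HB.pack f m : {multiplicative G -> H}).
Qed.

Lemma isomorphic_morph_inv (G H : groupType) (f : G -> H) :
  {morph f : x y / x * y} -> bijective f -> isomorphic H G.
Proof.
move=> fM [g fK gK]; apply: (@isomorphic_morph _ _ g); last by exists f.
by move=> x y; apply: (can_inj fK); rewrite fM !gK.
Qed.

Lemma inj_surj_bijective (T U : Type) (f : T -> U) :
  injective f -> (forall y, exists x, f x = y) -> bijective f.
Proof.
move=> fI fS; have [g gK] := choice fS.
by exists g => // x; apply: fI; rewrite gK.
Qed.

Lemma string_C_automorphism (G : groupType) n (rho : 'I_n -> G) :
  string_C_group rho ->
  isomorphic (automorphism_group (@face_le G n rho)) G.
Proof.
move=> sC.
apply: (@isomorphic_morph_inv G _ (@translation G n rho) (@translationM G n rho)).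
by apply: inj_surj_bijective; [exact: translation_inj|exact: translation_surj].
Qed.

(** * Morphisms and Coxeter generators *)

Section Morphisms.
Variables (G H : groupType) (f : G -> H).
Hypothesis fM : {morph f : x y / x * y}.

Lemma gmorph1 : f 1 = 1.
Proof. by apply: (mulgI (f 1)); rewrite -fM !mulg1. Qed.

Lemma gmorphV x : f x^-1 = (f x)^-1.
Proof. by apply: (mulgI (f x)); rewrite -fM !mulgV gmorph1. Qed.

Lemma gmorphX x k : f (x ^+ k) = f x ^+ k.
Proof. by elim: k => [|k IH]; rewrite ?expg0 ?gmorph1 // !expgS fM IH. Qed.

Lemma has_order_inj x k : injective f -> has_order x k -> has_order (f x) k.
Proof.
move=> fI [k0 xk kmin]; split=> // [|j j0]; first by rewrite -gmorphX xk gmorph1.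
by rewrite -gmorphX -gmorph1 => /fI; exact: kmin.
Qed.

End Morphisms.

Lemma has_order2 (G : groupType) (x : G) : x * x = 1 -> x <> 1 -> has_order x 2.
Proof.
by move=> xx x1; split=> // -[|[|j]] //; rewrite expg1.
Qed.

Lemma has_order4 (G : groupType) (x : G) :
  x ^+ 4 = 1 -> x ^+ 2 <> 1 -> has_order x 4.
Proof.
move=> x4 x2; split=> // -[|[|[|[|j]]]] // _; rewrite ?expg1 => e.
  by case: x2; rewrite e expg1n.
by move: x4; rewrite expgS e mulg1 => x1; case: x2; rewrite x1 expg1n.
Qed.

Lemma tperm_bool : tperm true false * tperm true false = 1 :> {perm bool}.
Proof. exact: tperm2. Qed.

Lemma tperm_bool_neq1 : tperm true false <> 1 :> {perm bool}.
Proof. by move=> /perm.permP /(_ true); rewrite tpermL perm1. Qed.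

Section CoxeterGenerators.
Variables (I : choiceType) (m : I -> I -> nat).

Lemma coxeter_lift_rel (G : groupType) (f : I -> G) :
  (forall i j, (f i * f j) ^+ m i j = 1) ->
  forall r, coxeter_relators m r -> weval f r = 1.
Proof. by move=> fm r [i [j ->]]; rewrite weval_coxeter. Qed.

(** The sign character, with values in a group of order two. *)
Lemma cgen_neq1 i : cgen m i <> 1.
Proof.
pose f (_ : I) : {perm bool} := tperm true false.
have fR : forall r, coxeter_relators m r -> weval f r = 1.
  by apply: coxeter_lift_rel => ? ?; rewrite tperm_bool expg1n.
move=> /(congr1 (plift f)); rewrite plift_gen // (gmorph1 (pliftM fR)).
exact: tperm_bool_neq1.
Qed.

Lemma coxeter_ind (P : coxeter m -> Prop) :
  (forall i, m i i = 1%N) -> P 1 ->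
  (forall x i, P x -> P (x * cgen m i)) -> forall x, P x.
Proof.
move=> m1 P1 PM x.
have inv i : (cgen m i)^-1 = cgen m i.
  by apply/invol_inv; have := cgen_rel m i i; rewrite m1 expg1.
rewrite -[x]reprK cls_weval; elim/last_ind: (repr x) => //= w [i b] IH.
rewrite -cats1 weval_cat /= mulg1.
by case: b => /=; rewrite ?inv; exact: PM.
Qed.

End CoxeterGenerators.

(** * The twisted power of a string C-group *)

Section Twisted.
Variables (U : groupType) (n : nat) (tau : 'I_n -> U).
Hypothesis sC : string_C_group tau.
Variables (alpha : U) (alphaC : forall g, commute alpha g) (s : nat).

Local Notation W := (vertex_group tau alpha s).
Local Notation act := (vertex_action tau alphaC s).
Local Notation F0 := (base_vertex tau).
Local Notation sg := (sigma (tau := tau) alpha s).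
Local Notation rho := (twisted_rho tau alphaC s).

Lemma sdM g u h v :
  SDPair act g u * SDPair act h v = SDPair act (g * h) (act u h * v).
Proof. by []. Qed.

Lemma actE F g : act (sg F) g = sg (vertex_mul F g).
Proof. exact: vertex_act_sigma. Qed.

Lemma act1 w : act w 1 = w.
Proof. exact: ract1. Qed.

Definition iota_U g := SDPair act g 1.
Definition kappa_W w := SDPair act 1 w.

Lemma iota_UM : {morph iota_U : g h / g * h}.
Proof. by move=> g h; rewrite /iota_U sdM ract_1 mulg1. Qed.

Lemma kappa_WM : {morph kappa_W : u v / u * v}.
Proof. by move=> u v; rewrite /kappa_W sdM act1 mulg1. Qed.

Lemma iota_U_inj : injective iota_U.
Proof. by move=> g h []. Qed.

Lemma kappa_W_inj : injective kappa_W.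
Proof. by move=> u v []. Qed.

Lemma sdE g w : SDPair act g w = iota_U g * kappa_W w.
Proof. by rewrite /iota_U /kappa_W sdM mulg1 act1 mul1g. Qed.

Lemma kappa_act w g : kappa_W (act w g) = iota_U g^-1 * kappa_W w * iota_U g.
Proof. by rewrite /iota_U /kappa_W !sdM ract_1 !mul1g mulg1 mulVg mulg1. Qed.

Lemma twisted_rho0 : rho ord0 = kappa_W (sg F0).
Proof. by rewrite /twisted_rho unlift_none. Qed.

Lemma twisted_rhoS j : rho (lift ord0 j) = iota_U (tau j).
Proof. by rewrite /twisted_rho liftK. Qed.

Lemma vertex_matrix_id F : vertex_matrix (tau := tau) alpha s F F = 1%N.
Proof. by rewrite /vertex_matrix eqxx. Qed.

Lemma sigma_invol F : sg F * sg F = 1.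
Proof.
by have := cgen_rel (vertex_matrix (tau := tau) alpha s) F F;
  rewrite vertex_matrix_id expg1.
Qed.

Lemma sigma_neq1 F : sg F <> 1.
Proof. exact: cgen_neq1. Qed.

(** The character that is nontrivial exactly on the two reflections of the
    antipodal pair of [F] separates them from the others; the pair is closed
    under [alpha] because [alpha] is an involution. *)
Lemma sigma_neq F F' : alpha * alpha = 1 -> F' <> F -> F' <> vertex_mul F alpha ->
  sg F' <> sg F.
Proof.
move=> aa neq neqa; pose t : {perm bool} := tperm true false.
pose f X := if (X == F) || (X == vertex_mul F alpha) then t else 1.
have tt : t * t = 1 := tperm_bool.
have fR : forall r, coxeter_relators (vertex_matrix alpha s) r -> weval f r = 1.
  apply: coxeter_lift_rel => X Y; rewrite /vertex_matrix.
  case: eqP => [->|_]; first by rewrite /f expg1; case: ifP; rewrite ?tt ?mulg1.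
  case: eqP => [->|_]; last first.
    rewrite /f expgS expg1; case: ifP => _; case: ifP => _;
    by rewrite ?mulg1 ?mul1g ?tt ?mulg1.
  have e : (vertex_mul X alpha == F) = (X == vertex_mul F alpha).
    rewrite -[RHS](inj_eq (@vertex_mulI _ _ tau alpha)).
    by rewrite -vertex_mulM aa vertex_mul1.
  rewrite /f e (inj_eq (@vertex_mulI _ _ tau alpha)).
  by case: (X == F); case: (X == vertex_mul F alpha);
    rewrite /= ?tt ?mulg1 expg1n.
move=> /(congr1 (plift f)); rewrite !plift_gen // /f eqxx.
by move/eqP/negPf: neq => ->; move/eqP/negPf: neqa => -> /esym/tperm_bool_neq1.
Qed.

Lemma vertex_stabE : vertex_stab tau = parabolic tau [set j | j != 0%N :> nat].
Proof. by []. Qed.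

Lemma vertexP F : exists g, F = vertex_mul F0 g.
Proof.
have /set_mem [g _ Fg] := valP F; exists g; apply: val_inj.
by rewrite -[val F]Fg /= right_coset_coset mul1g.
Qed.

Lemma eq_vertex g h :
  vertex_mul F0 g = vertex_mul F0 h <-> vertex_stab tau (h * g^-1).
Proof.
rewrite -(@eq_right_coset _ _ g h); last exact: generated_subgroup.
have valE k : val (vertex_mul F0 k) = right_coset (vertex_stab tau) k.
  by rewrite /= right_coset_coset mul1g.
by rewrite -!valE; split=> [->//|/val_inj].
Qed.

Definition tail_set (I : set 'I_n.+1) : set 'I_n := [set j | I (lift ord0 j)].

(** The vertices whose reflections generate the part in W of the standard
    subgroup of [I]; there are none unless [rho ord0] is among its generators. *)
Definition orbit_set (I : set 'I_n.+1) : set (vertex tau) :=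
  [set F | I ord0 /\ exists2 g, parabolic tau (tail_set I) g & F = vertex_mul F0 g].

(** The right-hand side is a subgroup because the orbit is stable under the
    standard subgroup of U; conversely each [sigma F] with [F] in the orbit is a
    conjugate of [rho ord0]. *)
Lemma parabolic_twisted I x : parabolic rho I x <->
  parabolic tau (tail_set I) (sd1 x) /\ generated (sg @` orbit_set I) (sd2 x).
Proof.
have actV u g : act u^-1 g = (act u g)^-1 by exact: gmorphV (@ractM _ _ act g) u.
have act_orb u g : parabolic tau (tail_set I) g ->
    generated (sg @` orbit_set I) u -> generated (sg @` orbit_set I) (act u g).
  move=> Ig; move: u; apply: (@generated_sub _ _
    [set u | generated (sg @` orbit_set I) (act u g)]).
    rewrite /mkset; split=> [|u v Iu Iv|u Iu].
    - by rewrite ract_1; exact: generated1.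
    - by rewrite ractM; exact: generatedM.
    - by rewrite actV; exact: generatedV.
  move=> _ [F [I0 [h Ih ->]] <-]; rewrite /mkset actE -vertex_mulM.
  apply: sub_generated; eexists; last reflexivity.
  by split=> //; exists (h * g) => //; exact: generatedM.
split.
  move: x; apply: (@generated_sub _ _ [set x | parabolic tau (tail_set I) (sd1 x)
    /\ generated (sg @` orbit_set I) (sd2 x)]).
    split=> [|[g u] [h v] [/= Ig Iu] [/= Ih Iv]|[g u] [/= Ig Iu]] /=.
    - by split; exact: generated1.
    - split; first exact: generatedM.
      by apply: generatedM => //; exact: act_orb.
    - have Ig' := generatedV Ig; split=> //.
      by apply: act_orb => //; exact: generatedV.
  move=> _ [i Ii <-] /=; case: (unliftP ord0 i) Ii => [j ->|->] Ii.
    rewrite twisted_rhoS; split; last exact: generated1.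
    exact: parabolic_gen.
  rewrite twisted_rho0; split; first exact: generated1.
  apply: sub_generated; exists F0 => //; split=> //.
  by exists 1; [exact: generated1|rewrite vertex_mul1].
case: x => g w /= [Ig Iw].
have iotaP h : parabolic tau (tail_set I) h -> parabolic rho I (iota_U h).
  move: h; apply: (parabolic_ind sC) => [|h j Ih Ij].
    by rewrite (gmorph1 iota_UM); exact: generated1.
  rewrite iota_UM; apply: generatedM => //; rewrite -twisted_rhoS.
  by apply: sub_generated; exists (lift ord0 j).
rewrite sdE; apply: generatedM; first exact: iotaP.
move: w Iw; apply: (@generated_sub _ _ [set w | parabolic rho I (kappa_W w)]).
  split=> [|u v Iu Iv|u Iu] /=; first by rewrite (gmorph1 kappa_WM); exact: generated1.
    by rewrite kappa_WM; exact: generatedM.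
  by rewrite (gmorphV kappa_WM); exact: generatedV.
move=> _ [F [I0 [h Ih ->]] <-] /=; rewrite -actE kappa_act -twisted_rho0.
apply: generatedM; last exact: iotaP.
apply: generatedM; first by apply: iotaP; exact: generatedV.
by apply: sub_generated; exists ord0.
Qed.

Lemma tail_setI I J : tail_set (I `&` J) = tail_set I `&` tail_set J.
Proof. by []. Qed.

(** If node [k] is missing, then every element of the standard subgroup is
    [b * a], where [a] uses only nodes below [k] and [b] only nodes above [k]; the
    latter fixes the base vertex, so that the orbit is that of the part of the
    diagram below [k]. *)
Lemma orbit_set_sub I J (k : 'I_n) : ~ tail_set I k ->
  (forall j : 'I_n, (j < k)%N -> tail_set J j) -> J ord0 ->
  orbit_set I `<=` orbit_set J.
Proof.
move=> Ik Jk J0 _ [I0 [g Ig ->]]; split=> //.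
have [a [b [aP bP gab ab]]] := parabolic_split sC Ik Ig.
exists a; first by apply: parabolicS aP => j [_ /Jk].
apply/eq_vertex; rewrite gab ab invgM mulgA mulgV mul1g vertex_stabE.
apply: generatedV; apply: parabolicS bP => j [_ /= kj].
by rewrite -lt0n (leq_trans _ kj).
Qed.

(** The least node missing from [I] or from [J] decides: below it both contain
    all nodes. *)
Lemma orbit_setI I J : orbit_set I `<=` orbit_set (I `&` J) \/
  orbit_set J `<=` orbit_set (I `&` J).
Proof.
have [I0|nI0] := pselect (I ord0); last by left=> F [].
have [J0|nJ0] := pselect (J ord0); last by right=> F [].
have [[k nk]|all] := pselect (exists k, ~ tail_set (I `&` J) k); last first.
  left=> F [_ [g _ ->]]; split=> //; exists g => //.
  apply: parabolicS (parabolicT sC g) => j _; apply: contrapT => nj.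
  by apply: all; exists j.
have [l /asboolP nl lmin] := @arg_minnP _ k (fun k => `[< ~ tail_set (I `&` J) k >])
  (@nat_of_ord n) (asboolT nk).
have below (j : 'I_n) : (j < l)%N -> tail_set (I `&` J) j.
  move=> jl; apply: contrapT => /asboolT/lmin; by rewrite leqNgt jl.
have [Il|Il] := pselect (tail_set I l); [right|left];
  apply: (@orbit_set_sub _ _ l) => // Jl; exact: nl.
Qed.

(** Intersections are taken componentwise.  On the W side the two subgroups are
    generated by nested sets of reflections, so that their intersection is the
    smaller one. *)
Lemma twisted_string_C : string_C_group rho.
Proof.
split; last first.
  move=> i j; case: (unliftP ord0 i) => [i'|] ->; case: (unliftP ord0 j) => [j'|] ->.
  - rewrite !twisted_rhoS -iota_UM -(gmorphX iota_UM) /= /bump !add1n !ltnS => ij.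
    by case: sC => _ ->; rewrite ?(gmorph1 iota_UM).
  - rewrite twisted_rho0 twisted_rhoS /= /bump add1n /= !ltnS => i0.
    have -> : iota_U (tau i') * kappa_W (sg F0) = SDPair act (tau i') (sg F0).
      by rewrite sdE.
    rewrite expgS expg1 sdM (rho_invol sC) actE.
    have -> : vertex_mul F0 (tau i') = F0.
      rewrite -[RHS]vertex_mul1; apply/eq_vertex; rewrite mul1g vertex_stabE.
      by apply: generatedV; apply: parabolic_gen; rewrite /= -lt0n.
    by rewrite sigma_invol.
  - rewrite twisted_rho0 twisted_rhoS /= /bump add1n /= !ltnS orbF => j0.
    have fix0 : vertex_mul F0 (tau j') = F0.
      rewrite -[RHS]vertex_mul1; apply/eq_vertex; rewrite mul1g vertex_stabE.
      by apply: generatedV; apply: parabolic_gen; rewrite /= -lt0n.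
    rewrite /kappa_W /iota_U sdM actE fix0 mulg1 mul1g.
    by rewrite expgS expg1 sdM (rho_invol sC) actE fix0 sigma_invol.
  - by [].
split.
- apply/seteqP; split=> // x _; apply/(parabolic_twisted setT x).
  split; first exact: (parabolicT sC).
  apply: (coxeter_ind (m := vertex_matrix alpha s)
    (P := generated (sg @` orbit_set setT)) vertex_matrix_id).
    exact: generated1.
  move=> w F Iw; apply: generatedM => //; apply: sub_generated; exists F => //.
  have [g ->] := vertexP F; split=> //; exists g => //.
  exact: (parabolicT sC).
- move=> i; case: (unliftP ord0 i) => [j|] ->.
    rewrite twisted_rhoS; apply: (has_order_inj iota_UM iota_U_inj).
    by case: sC => -[].
  rewrite twisted_rho0; apply: (has_order_inj kappa_WM kappa_W_inj).
  by apply: has_order2; [exact: sigma_invol|exact: sigma_neq1].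
- move=> I J; apply/seteqP; split=> x; last first.
    by move=> Ix; split; apply: generatedS Ix; apply: image_subset => ? [].
  move=> [/parabolic_twisted[Ig Iw] /parabolic_twisted[Jg Jw]].
  apply/(parabolic_twisted (I `&` J)); split.
    by rewrite tail_setI (parabolicI sC).
  by case: (orbit_setI I J) => sub; [move: Iw|move: Jw];
    apply: generatedS; exact: image_subset.
Qed.

End Twisted.

(** The square of [rho_0 rho_1] is the product of the reflections of two distinct,
    non-antipodal vertices, hence an involution. *)
Lemma twisted_schlafli (U : groupType) n (tau : 'I_n.+1 -> U) alpha
    (alphaC : forall g, commute alpha g) s p :
  string_C_group tau -> schlafli_type tau p -> alpha * alpha = 1 ->
  vertex_mul (base_vertex tau) (tau ord0) <> vertex_mul (base_vertex tau) alpha ->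
  schlafli_type (twisted_rho tau alphaC s) (4 :: p).
Proof.
move=> sC [sp tp] aa t0a; split; first by rewrite /= sp.
move=> i j; case: (unliftP ord0 i) => [i'|] ->; case: (unliftP ord0 j) => [j'|] -> //.
  have -> : nth 0%N (4 :: p) (lift ord0 i') = nth 0%N p i' by [].
  rewrite !twisted_rhoS -iota_UM [_ = _ :> nat]/= /bump !add1n => -[ij].
  apply: (has_order_inj (iota_UM tau alphaC s) (@iota_U_inj _ _ tau _ alphaC s)).
  exact: tp.
rewrite /= /bump add1n => -[j0]; have {j0 j'} -> : j' = ord0 by exact: val_inj.
rewrite twisted_rho0 twisted_rhoS.
set F0 := base_vertex tau in t0a *; set F1 := vertex_mul F0 (tau ord0) in t0a *.
have F10 : F1 <> F0.
  rewrite -[F0 in _ <> F0]vertex_mul1 /F1 => /eq_vertex.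
  rewrite mul1g (rhoV sC) vertex_stabE => t0; apply: (@rho_neq1 _ _ _ sC ord0).
  have : (parabolic tau [set j | j != 0%N :> nat] `&` parabolic tau [set ord0])
    (tau ord0) by split=> //; exact: parabolic_gen.
  rewrite -(parabolicI sC) (_ : _ `&` _ = set0).
    by rewrite /parabolic image_set0 generated0.
  by apply/seteqP; split=> // k [/= + k0]; rewrite k0.
have -> : kappa_W alphaC (sigma alpha s F0) * iota_U tau alphaC s (tau ord0) =
    SDPair (vertex_action tau alphaC s) (tau ord0) (sigma alpha s F1).
  by rewrite /kappa_W /iota_U sdM actE mul1g mulg1.
have F11 : vertex_mul F1 (tau ord0) = F0.
  by rewrite /F1 -vertex_mulM (rho_invol sC) vertex_mul1.
have x2 : SDPair (vertex_action tau alphaC s) (tau ord0) (sigma alpha s F1) ^+ 2 =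
    kappa_W alphaC (sigma alpha s F0 * sigma alpha s F1).
  by rewrite expgS expg1 sdM (rho_invol sC) actE F11.
apply: has_order4.
  rewrite (expgnA _ 2 2) x2 -(gmorphX (kappa_WM alphaC (s := s))).
  have := cgen_rel (vertex_matrix (tau := tau) alpha s) F0 F1.
  rewrite /vertex_matrix; move/eqP/negPf: F10 => ->; move/eqP/negPf: t0a => -> ->.
  exact: (gmorph1 (kappa_WM alphaC (s := s))).
rewrite x2 -(gmorph1 (kappa_WM alphaC (s := s))) => /kappa_W_inj h.
apply: (@sigma_neq _ _ tau alpha s F0 F1 aa F10 t0a).
by apply: (mulgI (sigma alpha s F0)); rewrite h sigma_invol.
Qed.

(** * Dihedral groups *)

Section DihedralWord.
Variables (s : nat) (s_gt0 : (0 < s)%N) (G : groupType) (a b : G).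
Hypotheses (aa : a * a = 1) (bb : b * b = 1) (ab : (a * b) ^+ s = 1).

Definition dihedral_word (z : nat * bool) : G :=
  (a * b) ^+ z.1 * (if z.2 then a else 1).

Definition dihedral_mul (z w : nat * bool) : nat * bool :=
  ((z.1 + (if z.2 then s.-1 * w.1 else w.1)) %% s, z.2 (+) w.2)%N.

Lemma dihedral_exp_mod k : (a * b) ^+ (k %% s) = (a * b) ^+ k.
Proof.
by rewrite [in RHS](divn_eq k s) mulnC expgnDr expgnA ab expg1n mul1g.
Qed.

Lemma dihedral_flip k : a * (a * b) ^+ k = (a * b) ^+ (s.-1 * k) * a.
Proof.
have flip : a * (a * b) = (a * b) ^+ s.-1 * a.
  have -> : (a * b) ^+ s.-1 = (a * b)^-1.
    by apply: (mulgI (a * b)); rewrite -expgS prednK // ab mulgV.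
  by rewrite invgM (invol_inv aa) (invol_inv bb) mulgA aa mul1g -mulgA aa mulg1.
elim: k => [|k IH]; first by rewrite muln0 !expg0 mulg1 mul1g.
by rewrite expgS mulgA flip -mulgA IH mulgA -expgnDr mulnS.
Qed.

Lemma dihedral_wordM z w :
  dihedral_word z * dihedral_word w = dihedral_word (dihedral_mul z w).
Proof.
case: z w => [k d] [l e]; rewrite /dihedral_word /= dihedral_exp_mod.
case: d => /=; rewrite ?mulg1 expgnDr -!mulgA // (mulgA a) dihedral_flip -mulgA.
by case: e; rewrite /= ?aa ?mulg1.
Qed.

Lemma dihedral_wordV : (b * a) ^+ s = 1.
Proof.
have -> : b * a = (a * b)^-1 by rewrite invgM (invol_inv aa) (invol_inv bb).
by rewrite expVgn ab invg1.
Qed.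

End DihedralWord.

Lemma card_dihedral_type s : (1 < s)%N -> #|{: 'D_(2 * s)}| = (2 * s)%N.
Proof. by move=> s1; rewrite mul2n -[LHS]cardsT card_dihedral. Qed.

(** The [2 * s] words in normal form exhaust the group, hence are distinct by
    counting; this makes [theta] well defined, with a target [G] that may be
    infinite. *)
Lemma dihedral_presentation s : (1 < s)%N -> exists a b : dihedral s,
  [/\ a * a = 1, b * b = 1, (a * b) ^+ s = 1,
      forall d, exists z, d = dihedral_word a b z &
      forall (G : groupType) (u v : G),
        u * u = 1 -> v * v = 1 -> (u * v) ^+ s = 1 ->
        exists2 theta : dihedral s -> G, {morph theta : x y / x * y} &
          forall z, theta (dihedral_word a b z) = dihedral_word u v z].
Proof.
move=> s1; have s0 : (0 < s)%N := ltnW s1.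
have card_D := card_dihedral_type s1.
have : [set: 'D_(2 * s)]%G \homg Grp (x : y : x ^+ 2, y ^+ 2, (x * y) ^+ s).
  by rewrite mul2n; apply: isoGrp_hom; exact: Grp'_dihedral.
case/existsP=> -[a b] /= /eqP[gen_ab aa bb ab].
rewrite !expg2 in aa bb.
pose ord_pair (z : nat * bool) : 'I_s * bool :=
  (Ordinal (ltn_pmod z.1 s0), z.2).
pose f (p : 'I_s * bool) := dihedral_word a b (p.1 : nat, p.2).
have fE z : dihedral_word a b z = f (ord_pair z).
  by rewrite /f /dihedral_word /= dihedral_exp_mod.
have f_surj d : d \in codom f.
  have S_group : group_set (finset (mem (codom f))).
    apply/group_setP; split=> [|x y]; rewrite ?inE.
      apply/codomP; exists (ord_pair (0%N, false)).
      by rewrite -fE /dihedral_word /= mulg1.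
    move=> /codomP[p ->] /codomP[p' ->]; apply/codomP.
    by rewrite /f (dihedral_wordM s0 aa bb ab) fE; eexists.
  have : d \in <[a]> <*> <[b]> by rewrite gen_ab inE.
  suff : <[a]> <*> <[b]> \subset fingroup.Group S_group.
    by move=> /fintype.subsetP h /h; rewrite inE.
  rewrite join_subG !cycle_subG !inE; apply/andP; split; apply/codomP.
    exists (ord_pair (0%N, true)); by rewrite -fE /dihedral_word /= mul1g.
  exists (ord_pair (s.-1, true)); rewrite -fE /dihedral_word /=.
  have -> : (a * b) ^+ s.-1 = (a * b)^-1.
    by apply: (mulgI (a * b)); rewrite -expgS prednK // ab mulgV.
  by rewrite invgM (invol_inv aa) (invol_inv bb) -mulgA aa mulg1.
have f_inj : injective f.
  have /image_injP fI : #|codom f| == #|{: 'I_s * bool}|.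
    rewrite (eq_card (B := predT)); last by move=> d; rewrite [LHS]f_surj.
    by rewrite card_D card_prod card_ord card_bool mulnC.
  by move=> p p' pp'; exact: fI isT isT pp'.
exists a, b; split=> // [d|G u v uu vv uv].
  by have /codomP[p ->] := f_surj d; eexists; reflexivity.
have word_mod z : dihedral_word u v (z.1 %% s, z.2)%N = dihedral_word u v z.
  by rewrite /dihedral_word /= dihedral_exp_mod.
pose theta d := let p := iinv (f_surj d) in dihedral_word u v (p.1 : nat, p.2).
have thetaE z : theta (dihedral_word a b z) = dihedral_word u v z.
  rewrite -word_mod /theta.
  have -> // : iinv (f_surj (dihedral_word a b z)) = ord_pair z.
  by apply: f_inj; rewrite f_iinv fE.
exists theta => // x y.
have /codomP[p ->] := f_surj x; have /codomP[p' ->] := f_surj y.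
by rewrite (dihedral_wordM s0 aa bb ab) !thetaE (dihedral_wordM s0 uu vv uv).
Qed.

(** * Products of dihedral groups *)

Lemma ffun_expg (aT : finType) (G : groupType) (h : {ffun aT -> G}) k x :
  (h ^+ k) x = h x ^+ k.
Proof.
elim: k => [|k IH]; first by rewrite !expg0 ffunE.
by rewrite !expgS ffunE IH.
Qed.

Lemma ffun_prod (aT : finType) (G : groupType) n (F : 'I_n -> {ffun aT -> G}) x :
  (\prod_k F k) x = \prod_k F k x.
Proof.
apply: (big_morph (fun h : {ffun aT -> G} => h x)) => [h h'|];
  by rewrite ffunE.
Qed.

Lemma prodg_only1 (G : groupType) n (k0 : 'I_n) (F : 'I_n -> G) :
  (forall k, k != k0 -> F k = 1) -> \prod_k F k = F k0.
Proof.
move=> F1; rewrite -(big_pred1_eq *%g k0 F) big_mkcond /=.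
by apply: eq_bigr => k _; case: eqP => // /eqP/F1.
Qed.

Lemma prodgM_commute (G : groupType) n (F F' : 'I_n -> G) :
  (forall k l, k != l -> commute (F k) (F' l)) ->
  \prod_k (F k * F' k) = \prod_k F k * \prod_k F' k.
Proof.
elim: n F F' => [|n IH] F F' FF'; first by rewrite !big_ord0 mulg1.
rewrite !big_ord_recl IH => [|k l kl]; last by apply: FF'.
rewrite -!mulgA; congr (_ * _); rewrite !mulgA; congr (_ * _).
by apply: commute_prod => k _; apply/commute_sym/FF'.
Qed.

(** The morphism [phi] sends each generator to a reflection in one factor, and
    [psi] multiplies the morphisms from the factors, whose images commute
    pairwise; both composites are identities, as seen on generators. *)
Lemma coxeter_dihedral_power (I : choiceType) (m : I -> I -> nat) (s q : nat)
    (e : I -> 'I_q * bool) (e' : 'I_q * bool -> I) :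
  (1 < s)%N -> cancel e e' -> cancel e' e ->
  (forall i j, m i j = if e i == e j then 1%N
     else if (e i).1 == (e j).1 then s else 2) ->
  isomorphic (coxeter m) {ffun 'I_q -> dihedral s}.
Proof.
move=> s1 eK e'K mE; have s0 := ltnW s1.
have [a [b [aa bb ab D_word D_univ]]] := dihedral_presentation s1.
pose r (c : bool) := if c then b else a.
pose f i : {ffun 'I_q -> dihedral s} :=
  [ffun k => if k == (e i).1 then r (e i).2 else 1].
have rr c : r c * r c = 1 by case: c.
have ba : (b * a) ^+ s = 1 := dihedral_wordV aa bb ab.
have f_rel i j : (f i * f j) ^+ m i j = 1.
  apply/ffunP => k; rewrite ffun_expg mE !ffunE -pair_eqE /= /pair_eq.
  case: (eqVneq (e i).1 (e j).1) => [-> | neq] /=.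
    case: (eqVneq (e i).2 (e j).2) => [->|neq].
      by rewrite expg1; case: ifP; rewrite ?rr ?mulg1.
    case: ifP => _; last by rewrite mulg1 expg1n.
    by case: (e i).2 (e j).2 neq => -[].
  case: (eqVneq k (e i).1) => [->|_]; first by rewrite (negPf neq) mulg1 expg2.
  by rewrite mul1g expg2; case: ifP; rewrite ?rr ?mulg1.
have fR := coxeter_lift_rel f_rel.
pose phi (w : coxeter m) := plift f w.
have phiM : {morph phi : x y / x * y} := pliftM fR.
have phi_gen i : phi (cgen m i) = f i := plift_gen fR i.
pose g k c : coxeter m := cgen m (e' (k, c)).
have g_rel k c k' c' n : m (e' (k, c)) (e' (k', c')) = n -> (g k c * g k' c') ^+ n = 1.
  by move=> <-; exact: cgen_rel.
have gg k c : g k c * g k c = 1 by rewrite -[LHS]expg1 (g_rel _ _ _ _ 1%N) // mE eqxx.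
have /choice[theta theta_spec] k : exists theta : dihedral s -> coxeter m,
    {morph theta : x y / x * y} /\
    forall z, theta (dihedral_word a b z) = dihedral_word (g k false) (g k true) z.
  have [||| theta thM thE] := D_univ _ (g k false) (g k true); try exact: gg.
    by apply: g_rel; rewrite mE !e'K /= xpair_eqE andbF eqxx.
  by exists theta.
have thetaM k := (theta_spec k).1; have thetaE k := (theta_spec k).2.
have theta_a k : theta k a = g k false.
  by have := thetaE k (0%N, true); rewrite /dihedral_word /= !mul1g.
have theta_b k : theta k b = g k true.
  have := thetaE k (1%N, false); rewrite /dihedral_word /= !mulg1 !expg1 thetaM theta_a.
  exact: mulgI.
have g_comm k l c d : k != l -> commute (g k c) (g l d).
  move=> kl; have := g_rel k c l d 2; rewrite mE !e'K xpair_eqE (negPf kl) /=.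
  move=> /(_ erefl); rewrite expg2 => /invol_inv.
  by rewrite invgM !(invol_inv (gg _ _)).
have theta_comm k l x y : k != l -> commute (theta k x) (theta l y).
  move=> kl; have [z ->] := D_word x; have [w ->] := D_word y; rewrite !thetaE.
  have word_comm u n c z' : (forall d, commute u (g n d)) ->
      commute u (dihedral_word (g n c) (g n (~~ c)) z').
    move=> ug; apply: commuteM; first by apply/commuteX/commuteM.
    by case: z'.2; [|exact: commute1].
  apply: (word_comm _ l false) => d; apply/commute_sym.
  by apply: (word_comm _ k false) => d'; apply/g_comm; rewrite eq_sym.
pose psi (h : {ffun 'I_q -> dihedral s}) : coxeter m := \prod_k theta k (h k).
have psiM : {morph psi : h h' / h * h'}.
  move=> h h'; rewrite /psi -prodgM_commute => [|k l]; last exact: theta_comm.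
  by apply: eq_bigr => k _; rewrite ffunE thetaM.
have psi_f i : psi (f i) = cgen m i.
  rewrite /psi (prodg_only1 (k0 := (e i).1)) => [|k /negPf ki].
    rewrite ffunE eqxx /r -[in RHS](eK i) [e i in RHS]surjective_pairing.
    by case: (e i).2; rewrite ?theta_a ?theta_b.
  by rewrite ffunE ki (gmorph1 (thetaM k)).
have phiK : cancel phi psi.
  apply: (pmorph_ext (f := psi \o phi) (g := id)) => [x y|//|i] /=.
    by rewrite phiM psiM.
  by rewrite phi_gen psi_f.
have phi_theta k x : phi (theta k x) = [ffun l => if l == k then x else 1].
  have [z ->] := D_word x; rewrite thetaE /dihedral_word phiM (gmorphX phiM) phiM.
  have -> : phi (if z.2 then g k false else 1) =
      if z.2 then phi (g k false) else 1 by case: z.2; rewrite ?(gmorph1 phiM).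
  rewrite !phi_gen; apply/ffunP => l; rewrite !(ffunE, ffun_expg) !e'K /=.
  case: (eqVneq l k) => [->|/negPf lk]; case: z.2;
    rewrite ?ffunE ?e'K /= ?eqxx ?lk //;
  by rewrite !mulg1 expg1n.
apply: (isomorphic_morph phiM); exists psi => // h.
apply/ffunP => l; rewrite /psi (big_morph phi phiM (gmorph1 phiM)) ffun_prod.
rewrite (prodg_only1 (k0 := l)) => [|k kl]; rewrite phi_theta ffunE ?eqxx //.
by rewrite eq_sym (negPf kl).
Qed.

(** * Normal forms in the group [5,3] *)

Definition t53 (k : nat) : cox53 := tau53 (inord k).

Local Notation "[ 'w' w ]" := (nval t53 w) (format "[ 'w'  w ]").

Lemma tau53E (i : 'I_3) : tau53 i = t53 i.
Proof. by rewrite /t53 inord_val. Qed.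

Lemma tau53_rel (i j : 'I_3) k :
  @string_matrix [:: 5; 3] i j = k -> (tau53 i * tau53 j) ^+ k = 1.
Proof. by move=> <-; exact: cgen_rel. Qed.

Lemma tau53_invol i : tau53 i * tau53 i = 1.
Proof. by rewrite -[LHS]expg1 tau53_rel // /string_matrix eqxx. Qed.

Lemma t53_invol k : t53 k * t53 k = 1.
Proof. exact: tau53_invol. Qed.

Definition matrix53 (i j : nat) : nat :=
  if i == j then 1%N
  else if (i.+1 == j) || (j.+1 == i) then nth 0%N [:: 5; 3] (minn i j) else 2.

Lemma t53_rel i j : (i < 3)%N -> (j < 3)%N ->
  [w flatten (nseq (matrix53 i j) [:: i; j])] = 1.
Proof.
move=> i3 j3.
have -> : matrix53 i j = @string_matrix [:: 5; 3] (inord i) (inord j).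
  by rewrite /string_matrix -val_eqE /= !inordK.
rewrite -[RHS](cgen_rel (@string_matrix [:: 5; 3]) (inord i) (inord j)).
elim: (string_matrix _ _) => //= k IH; by rewrite expgS IH !mulgA.
Qed.

Lemma nval_rev w : [w rev w] = [w w]^-1.
Proof.
elim: w => [|k w IH] /=; first by rewrite invg1.
by rewrite rev_cons -cats1 nval_cat IH invgM (invol_inv (t53_invol k)) /= mulg1.
Qed.

Lemma nval_eq_rev l r : [w l ++ rev r] = 1 -> [w l] = [w r].
Proof.
by rewrite nval_cat nval_rev => h; rewrite -[LHS](mulgVK [w r]) h mul1g.
Qed.

(** The braid moves and cancellations: in each, [l ++ rev r] is a defining
    relator. *)
Definition braid53 : seq (seq nat * seq nat) :=
  [:: ([:: 0; 1; 0; 1; 0], [:: 1; 0; 1; 0; 1]);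
      ([:: 1; 0; 1; 0; 1], [:: 0; 1; 0; 1; 0]);
      ([:: 1; 2; 1], [:: 2; 1; 2]); ([:: 2; 1; 2], [:: 1; 2; 1]);
      ([:: 0; 2], [:: 2; 0]); ([:: 2; 0], [:: 0; 2]);
      ([:: 0; 0], [::]); ([:: 1; 1], [::]); ([:: 2; 2], [::])]%N.

Lemma braid53_sound : {in braid53, forall lr, [w lr.1] = [w lr.2]}.
Proof.
have /allP braidP : all (fun lr => has (fun i => has (fun j =>
    lr.1 ++ rev lr.2 == flatten (nseq (matrix53 i j) [:: i; j]))
    (iota 0 3)) (iota 0 3)) braid53 by [].
move=> lr /braidP/hasP[i] /[!mem_iota] i3 /hasP[j] /[!mem_iota] j3 /eqP e.
by apply: nval_eq_rev; rewrite e t53_rel.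
Qed.

(** The complete rewriting system of [5,3] for the shortlex order. *)
Definition rules53 : seq (seq nat * seq nat) :=
  [:: ([:: 0; 0], [::]); ([:: 1; 1], [::]); ([:: 2; 2], [::]);
      ([:: 2; 0], [:: 0; 2]); ([:: 2; 1; 2], [:: 1; 2; 1]);
      ([:: 2; 1; 0; 2], [:: 1; 2; 1; 0]);
      ([:: 1; 0; 1; 0; 1], [:: 0; 1; 0; 1; 0]);
      ([:: 2; 1; 0; 1; 2; 1], [:: 1; 2; 1; 0; 1; 2]);
      ([:: 2; 1; 0; 1; 0; 2; 1; 0; 1; 0],
       [:: 1; 2; 1; 0; 1; 0; 2; 1; 0; 1])]%N.

Lemma rules53_sound : {in rules53, forall lr, [w lr.1] = [w lr.2]}.
Proof.
(* one sequence of braid moves, as (position, rule) pairs, for each rule *)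
pose ds : seq (seq (nat * nat)) :=
  [:: [:: (0, 6)]; [:: (0, 7)]; [:: (0, 8)]; [:: (0, 5)]; [:: (0, 3)];
      [:: (2, 4); (0, 3)]; [:: (0, 1)]; [:: (3, 2); (2, 4); (0, 3)];
      [:: (4, 4); (5, 0); (3, 2); (2, 4); (0, 3); (5, 5)]]%N.
have dsP : all (fun p => foldl (derive1 braid53) p.1.1 p.2 == p.1.2)
    (zip rules53 ds) by [].
have /allP h : all (fun lr => [w lr.1] == [w lr.2]) (unzip1 (zip rules53 ds)).
  rewrite all_map; apply: sub_all dsP => -[[l r] ps] /= /eqP <-; apply/eqP.
  by rewrite derivation //; exact: braid53_sound.
by move=> lr /h/eqP.
Qed.

Definition matching53 (w : seq nat) : seq (seq nat * seq nat) :=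
  [seq lr <- rules53 | suffix lr.1 w].

(** Multiplication of a normal form by a generator: append the letter, then
    reduce the suffix that it completes.  The fuel bounds the nesting of the
    reductions; on the normal forms of [5,3] it never exceeds four. *)
Fixpoint push (fuel : nat) (w : seq nat) (k : nat) : seq nat :=
  let w' := rcons w k in
  match fuel, matching53 w' with
  | fuel'.+1, lr :: _ => foldl (push fuel') (take (size w' - size lr.1) w') lr.2
  | _, _ => w'
  end.

Lemma nval_rcons w k : [w rcons w k] = [w w] * t53 k.
Proof. by rewrite -cats1 nval_cat /= mulg1. Qed.

Lemma push_sound fuel w k : [w push fuel w k] = [w w] * t53 k.
Proof.
rewrite -nval_rcons; elim: fuel w k => // fuel IH w k /=.
set w' := rcons w k.
case E: (matching53 w') => [//|[l r] lrs].
have : (l, r) \in matching53 w' by rewrite E mem_head.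
rewrite mem_filter => /andP[/suffixP[u w'E] /rules53_sound /= lr].
rewrite w'E size_cat addnK take_size_cat // nval_cat lr.
elim: r u {lr E w'E} => [|j r IHr] u /=; first by rewrite mulg1.
by rewrite IHr IH nval_rcons mulgA.
Qed.

Definition prefixes (w : seq nat) : seq (seq nat) :=
  [seq take i w | i <- iota 0 (size w).+1].

(** The normal forms: products of words, one for each coset of 1 in <tau_0>, of
    <tau_0> in <tau_0, tau_1>, and of <tau_0, tau_1> in the whole group; the last
    cosets are the twelve facets of the dodecahedron. *)
Definition words53 : seq (seq nat) :=
  [seq u ++ v |
    u <- [seq x ++ y | x <- prefixes [:: 0], y <- prefixes [:: 1; 0; 1; 0]],
    v <- [:: 2; 1; 0; 1; 2] :: prefixes [:: 2; 1; 0; 1; 0; 2; 1; 0; 1; 2]]%N.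

Lemma push_words53 w k : w \in words53 -> (k < 3)%N ->
  push 4 w k \in words53 /\ {subset push 4 w k <= rcons w k}.
Proof.
have /allP h : all (fun w => all (fun k => (push 4 w k \in words53) &&
    all (mem (rcons w k)) (push 4 w k)) (iota 0 3)) words53 by vm_compute.
move=> /h/allP hw k3; have /hw/andP[-> /allP] // : k \in iota 0 3.
by rewrite mem_iota.
Qed.

Lemma words53_lt3 w k : w \in words53 -> k \in w -> (k < 3)%N.
Proof.
have /allP h : all (all (fun k => k < 3)%N) words53 by vm_compute.
by move=> /h/allP; apply.
Qed.

Lemma words53_ex (g : cox53) : exists2 w, w \in words53 & g = [w w].
Proof.
move: g; apply: coxeter_ind => [i||g i [w wP ->]].
- by rewrite /string_matrix eqxx.
- by exists [::].
exists (push 4 w i); first exact: (push_words53 wP (ltn_ord i)).1.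
by rewrite push_sound -tau53E.
Qed.

(** * The action on the twenty vertices *)

(** Row [k] is the action of tau_k on the vertices of the dodecahedron, numbered
    so that the base vertex is 0 and that the antipode of [x] is [x + 10] modulo
    20. *)
Definition vertices53 : seq (seq nat) :=
  [:: [:: 1; 0; 3; 2; 6; 5; 4; 7; 19; 18; 11; 10; 13; 12; 16; 15; 14; 17; 9; 8];
      [:: 0; 2; 1; 5; 4; 3; 8; 9; 6; 7; 10; 12; 11; 15; 14; 13; 18; 19; 16; 17];
      [:: 0; 1; 4; 6; 2; 7; 3; 5; 9; 8; 10; 11; 14; 16; 12; 17; 13; 15; 19; 18]]%N.

Definition step53 (x k : nat) : nat := nth 0%N (nth [::] vertices53 k) x.

Lemma step53P k x : (k < 3)%N -> (x < 20)%N ->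
  (step53 x k < 20)%N /\ step53 (step53 x k) k = x.
Proof.
have /allP h : all (fun k => all (fun x => (step53 x k < 20)%N &&
    (step53 (step53 x k) k == x)) (iota 0 20)) (iota 0 3) by vm_compute.
move=> k3 x20; have /h/allP hk : k \in iota 0 3 by rewrite mem_iota.
by have /hk/andP[-> /eqP] : x \in iota 0 20 by rewrite mem_iota.
Qed.

Definition step_fun (k : 'I_3) (x : 'I_20) : 'I_20 := inord (step53 x k).

Lemma val_step_fun k x : step_fun k x = step53 x k :> nat.
Proof. by rewrite /step_fun inordK // (step53P (ltn_ord k) (ltn_ord x)).1. Qed.

Lemma step_fun_inj k : injective (step_fun k).
Proof.
apply: (can_inj (g := step_fun k)) => x; apply: val_inj.
by rewrite /= !val_step_fun (step53P (ltn_ord k) (ltn_ord x)).2.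
Qed.

Definition step_perm (k : 'I_3) : {perm 'I_20} := perm (@step_fun_inj k).

Lemma val_weval_step (w : seq 'I_3) (x : 'I_20) :
  weval step_perm [seq (k, false) | k <- w] x =
  foldl step53 x [seq val k | k <- w] :> nat.
Proof.
elim: w x => [|k w IH] x /=; first by rewrite perm1.
by rewrite permM IH permE val_step_fun.
Qed.

Lemma step_perm_rel i j :
  (step_perm i * step_perm j) ^+ @string_matrix [:: 5; 3] i j = 1.
Proof.
apply/perm.permP => x; apply: val_inj; rewrite perm1 /=.
have -> : (step_perm i * step_perm j) ^+ @string_matrix [:: 5; 3] i j =
  weval step_perm [seq (k, false) |
    k <- flatten (nseq (@string_matrix [:: 5; 3] i j) [:: i; j])].
  by elim: (@string_matrix [:: 5; 3] i j) => //= k IH; rewrite expgS IH mulgA.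
rewrite val_weval_step map_flatten map_nseq /=.
have -> : @string_matrix [:: 5; 3] i j = matrix53 i j.
  by rewrite /string_matrix -val_eqE.
have /allP h : all (fun i => all (fun j => all (fun x =>
    foldl step53 x (flatten (nseq (matrix53 i j) [:: i; j])) == x)
    (iota 0 20)) (iota 0 3)) (iota 0 3) by vm_compute.
have /h/allP hi : val i \in iota 0 3 by rewrite mem_iota ltn_ord.
have /hi/allP hij : val j \in iota 0 3 by rewrite mem_iota ltn_ord.
by have /hij/eqP : val x \in iota 0 20 by rewrite mem_iota ltn_ord.
Qed.

Definition rep53 : cox53 -> {perm 'I_20} := plift step_perm.

Lemma rep53M : {morph rep53 : g h / g * h}.
Proof. exact: pliftM (coxeter_lift_rel step_perm_rel). Qed.

Lemma rep53_nval w (x : 'I_20) : all (gtn 3) w ->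
  rep53 [w w] x = foldl step53 x w :> nat.
Proof.
elim: w x => [|k w IH] x /=; first by rewrite (gmorph1 rep53M) perm1.
case/andP=> k3 w3; rewrite rep53M permM IH //; congr (foldl _ _ w).
rewrite /t53 /tau53 [rep53 _](plift_gen (coxeter_lift_rel step_perm_rel)).
by rewrite permE val_step_fun inordK.
Qed.

Definition trace53 (w : seq nat) : seq nat :=
  [seq foldl step53 x w | x <- iota 0 20].

Lemma trace53_eq w w' : all (gtn 3) w -> all (gtn 3) w' ->
  [w w] = [w w'] -> trace53 w = trace53 w'.
Proof.
move=> w3 w'3 ww'; apply/eq_in_map => x; rewrite mem_iota /= => x20.
by rewrite -[x]/(val (Ordinal x20)) -!rep53_nval // ww'.
Qed.

Lemma words53_all w : w \in words53 -> all (gtn 3) w.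
Proof. by move=> wP; apply/allP => k /(words53_lt3 wP). Qed.

Lemma uniq_map_inj (T : eqType) (U : eqType) (f : T -> U) (xs : seq T) :
  uniq (map f xs) -> {in xs &, injective f}.
Proof.
move=> u x y xP yP e; rewrite -(nth_index x xP) -(nth_index x yP).
congr (nth _ _ _); apply/eqP.
rewrite -(nth_uniq (f x) _ _ u) ?size_map ?index_mem //.
by rewrite !(nth_map x) ?index_mem // !nth_index // e.
Qed.

Lemma words53_trace : {in words53 &, injective trace53}.
Proof. by apply: uniq_map_inj; vm_compute. Qed.

Lemma nval_inj : {in words53 &, injective (nval t53)}.
Proof.
by move=> w w' wP w'P /trace53_eq e; apply: words53_trace => //; apply: e;
  exact: words53_all.
Qed.

Definition nf53 (g : cox53) : seq nat := sval (cid2 (words53_ex g)).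

Lemma nf53_words g : nf53 g \in words53.
Proof. by rewrite /nf53; case: cid2. Qed.

Lemma nf53K g : [w nf53 g] = g.
Proof. by rewrite /nf53; case: cid2. Qed.

Lemma nval53K w : w \in words53 -> nf53 [w w] = w.
Proof. by move=> wP; apply: nval_inj => //; [exact: nf53_words|exact: nf53K]. Qed.

Lemma nf53_gen g (i : 'I_3) : nf53 (g * tau53 i) = push 4 (nf53 g) i.
Proof.
rewrite -[RHS]nval53K; last exact: (push_words53 (nf53_words g) (ltn_ord i)).1.
by rewrite push_sound nf53K -tau53E.
Qed.

Lemma trace53_inj w w' : all (gtn 3) w -> all (gtn 3) w' ->
  trace53 w = trace53 w' -> [w w] = [w w'].
Proof.
move=> w3 w'3 ww'; rewrite -(nf53K [w w]) -(nf53K [w w']); congr nval.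
have nfP g := words53_all (nf53_words g).
apply: words53_trace; try exact: nf53_words.
by rewrite (trace53_eq (nfP _) w3 (nf53K _)) (trace53_eq (nfP _) w'3 (nf53K _)).
Qed.

Lemma size_words53 : size words53 = 120.
Proof. by []. Qed.

Lemma uniq_words53 : uniq words53.
Proof. by vm_compute. Qed.

(** * The group [5,3] as a string C-group *)

Lemma nval_expg w k : [w flatten (nseq k w)] = [w w] ^+ k.
Proof. by elim: k => //= k IH; rewrite nval_cat IH expgS. Qed.

(** A normal form uses only the generators that are needed, because reduction
    creates no new letters. *)
Lemma parabolic53P (I : set 'I_3) g :
  parabolic tau53 I g <-> forall k, k \in nf53 g -> I (inord k).
Proof.
split; last first.
  rewrite -{2}(nf53K g); elim: (nf53 g) => [|k w IH] wI /=; first exact: generated1.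
  apply: generatedM; last by apply: IH => j jw; apply: wI; rewrite inE jw orbT.
  by apply: sub_generated; exists (inord k) => //; apply: wI; exact: mem_head.
move: g; apply: generated_ind => [_ [i Ii <-]||g _ gI [i Ii <-]].
- by exists i => //; rewrite (invol_inv (tau53_invol i)).
- by rewrite -[1]/[w [::]] nval53K.
rewrite nf53_gen => k /(push_words53 (nf53_words g) (ltn_ord i)).2.
rewrite mem_rcons inE => /predU1P[->|]; first by rewrite inord_val.
exact: gI.
Qed.

Lemma tau53_string_C : string_C_group tau53.
Proof.
split; last first.
  move=> i j ij; apply: tau53_rel; move: ij.
  by case: i j => [[|[|[|?]]] ?] [[|[|[|?]]] ?].
split.
- apply/seteqP; split=> // g _; rewrite -[generated _]/(parabolic tau53 setT).
  exact/parabolic53P.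
- move=> i; apply: has_order2; first exact: tau53_invol.
  exact: cgen_neq1.
- move=> I J; apply/seteqP; split=> g.
    move=> [/parabolic53P Ig /parabolic53P Jg]; apply/parabolic53P => k kg.
    by split; [exact: Ig|exact: Jg].
  by move=> IJg; split; apply: generatedS IJg; apply: image_subset => ? [].
Qed.

Lemma tau53_order (i j : 'I_3) m : @string_matrix [:: 5; 3] i j = m -> (0 < m)%N ->
  all (fun k => trace53 (flatten (nseq k [:: val i; val j])) != iota 0 20)
    (iota 1 m.-1) ->
  has_order (tau53 i * tau53 j) m.
Proof.
move=> ijm m0 /allP h; split=> // [|k k0 xk]; first exact: tau53_rel.
rewrite leqNgt; apply/negP => km.
have /h/eqP : k \in iota 1 m.-1 by rewrite mem_iota k0 add1n prednK.
apply; rewrite -[RHS]/(trace53 [::]); apply: trace53_eq => //.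
  by elim: {xk km k0 h} k => //= k ->; rewrite !ltn_ord.
rewrite nval_expg /= mulg1 -xk; congr (_ ^+ _).
by rewrite !tau53E.
Qed.

Lemma tau53_schlafli : schlafli_type tau53 [:: 5; 3].
Proof.
split=> // i j ij; apply: tau53_order.
- by case: i j ij => [[|[|[|?]]] ?] [[|[|[|?]]] ?].
- by case: i j ij => [[|[|[|?]]] ?] [[|[|[|?]]] ?].
- by case: i j ij => [[|[|[|?]]] ?] [[|[|[|?]]] ?] //= _ _; vm_compute.
Qed.

(** * The vertices of the dodecahedron *)

Local Notation F0 := (base_vertex tau53).

Definition beta53 : cox53 := [w [:: 0; 1; 2]%N].

Lemma alpha53E : alpha53 = beta53 ^+ 5.
Proof. by rewrite /beta53 /= mulg1 mulgA. Qed.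

Lemma alpha53_word : alpha53 = [w flatten (nseq 5 [:: 0; 1; 2])]%N.
Proof. by rewrite nval_expg alpha53E. Qed.

Lemma alpha53_invol : alpha53 * alpha53 = 1.
Proof.
rewrite alpha53_word -nval_cat -[1]/[w [::]]; exact: trace53_inj.
Qed.

Lemma rep53_alpha (x : 'I_20) : rep53 alpha53 x = (x + 10) %% 20 :> nat.
Proof.
rewrite alpha53_word rep53_nval //.
have /allP h : all (fun x => foldl step53 x (flatten (nseq 5 [:: 0; 1; 2])) ==
    (x + 10) %% 20)%N (iota 0 20) by vm_compute.
by apply/eqP/h; rewrite mem_iota ltn_ord.
Qed.

(** Among the 120 normal forms, those that fix the base vertex do not involve the
    letter 0. *)
Lemma vertex_stab53P g : vertex_stab tau53 g <-> rep53 g ord0 = ord0.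
Proof.
split.
  move: g; apply: (@generated_sub _ _ [set g | rep53 g ord0 = ord0]).
    split=> [|g h /= g0 h0|g /= g0] /=.
    - by rewrite (gmorph1 rep53M) perm1.
    - by rewrite rep53M permM g0.
    - by rewrite (gmorphV rep53M) -{1}g0 permK.
  move=> _ [j j0 <-] /=; apply: val_inj; rewrite /= tau53E.
  rewrite -[t53 j]mulg1 -[t53 j * 1]/[w [:: (j : nat)]] rep53_nval.
    by case: j j0 => [[|[|[|?]]] ?].
  by rewrite /= ltn_ord.
move=> g0; rewrite vertex_stabE; apply/parabolic53P => k kg /=.
have /allP h : all (fun w => (foldl step53 0 w == 0) ==> (0 \notin w))%N words53.
  by vm_compute.
have /h/implyP := nf53_words g.
have -> : foldl step53 0%N (nf53 g) == 0%N.
  by rewrite -[0%N]/(val (@ord0 19)) -rep53_nval ?words53_all ?nf53K ?g0 // nf53_words.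
have k3 := words53_lt3 (nf53_words g) kg.
by move=> /(_ isT) g00; rewrite inordK //; apply: contraNneq g00 => <-.
Qed.

Lemma vertex53_eq g h :
  vertex_mul F0 g = vertex_mul F0 h <-> rep53 g ord0 = rep53 h ord0.
Proof.
rewrite (eq_vertex tau53 g h); rewrite vertex_stab53P rep53M (gmorphV rep53M) permM.
by split=> [e|<-]; [rewrite -{1}e permKV|rewrite permK].
Qed.

(** The stabilizer of the base vertex and the powers of [beta53] along a
    Petrie polygon carry the base vertex to every vertex: the six orbits of
    the stabilizer are the distance classes. *)
Lemma vertex53_orbit F : exists i v,
  [/\ (i < 6)%N, vertex_stab tau53 v & F = vertex_mul F0 (beta53 ^+ i * v)].
Proof.
have [g ->] := vertexP F.
pose V : seq (seq nat) := [:: [::]; [:: 1]; [:: 2]; [:: 1; 2]; [:: 2; 1]; [:: 1; 2; 1]]%N.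
have /allP h : all (fun x => has (fun i => has (fun v =>
    foldl step53 0 (flatten (nseq i [:: 0; 1; 2]) ++ v) == x) V) (iota 0 6))%N
    (iota 0 20) by vm_compute.
have /h/hasP[i /[!mem_iota] i6 /hasP[v vV /eqP e]] : (rep53 g ord0 : nat) \in iota 0 20.
  by rewrite mem_iota ltn_ord.
have /allP VP : all (fun v => (foldl step53 0 v == 0) && all (gtn 3) v)%N V by [].
have /andP[/eqP v0 v3] := VP v vV.
exists i, [w v]; split=> //.
  by apply/vertex_stab53P; apply: val_inj; rewrite /= rep53_nval.
apply/vertex53_eq; apply: val_inj; rewrite /= -[LHS]e -nval_expg -nval_cat.
rewrite rep53_nval // all_cat v3 andbT.
by elim: i {i6 e} => //= i ->.
Qed.

Definition vertex_point (F : vertex tau53) : 'I_20 :=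
  rep53 (sval (cid (vertexP F))) ord0.

Lemma vertex_pointE g : vertex_point (vertex_mul F0 g) = rep53 g ord0.
Proof. by rewrite /vertex_point; case: cid => h /= /vertex53_eq. Qed.

Lemma vertex_point_inj : injective vertex_point.
Proof.
move=> F F'; have [g ->] := vertexP F; have [g' ->] := vertexP F'.
by rewrite !vertex_pointE => /vertex53_eq.
Qed.

Lemma vertex_point_surj x : exists F, vertex_point F = x.
Proof.
have /allP h : all (fun x => has (fun w => foldl step53 0 w == x) words53)%N
  (iota 0 20) by vm_compute.
have /h/hasP[w wP /eqP e] : val x \in iota 0 20 by rewrite mem_iota ltn_ord.
exists (vertex_mul F0 [w w]); rewrite vertex_pointE; apply: val_inj.
by rewrite /= rep53_nval ?words53_all.
Qed.

Lemma vertex_point_alpha F :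
  vertex_point (vertex_mul F alpha53) = (vertex_point F + 10) %% 20 :> nat.
Proof.
have [g ->] := vertexP F.
by rewrite -vertex_mulM !vertex_pointE rep53M permM rep53_alpha.
Qed.

(** Numbering the ten antipodal pairs identifies W with the tenth power of
    the dihedral group. *)
Lemma W53_dihedral s : (1 < s)%N -> isomorphic (W53 s) {ffun 'I_10 -> dihedral s}.
Proof.
move=> s1.
pose enc (x : 'I_20) : 'I_10 * bool := (inord (x %% 10)%N, 10 <= x)%N.
pose dec (p : 'I_10 * bool) : 'I_20 := inord (p.1 + p.2 * 10).
have enc1 x : (enc x).1 = x %% 10 :> nat by rewrite inordK // ltn_pmod.
have encK : cancel enc dec.
  move=> x; have /allP h : all (fun x => x %% 10 + (10 <= x) * 10 == x)%N (iota 0 20).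
    by vm_compute.
  have /h/eqP xE : (x : nat) \in iota 0 20 by rewrite mem_iota ltn_ord.
  by rewrite /dec enc1 /= xE inord_val.
have decE p : dec p = p.1 + p.2 * 10 :> nat.
  rewrite inordK //; case: p => [i []] /=; rewrite ?mul1n ?mul0n ?addn0.
    by rewrite (ltn_add2r 10 i 10).
  exact: leq_trans (ltn_ord i) _.
have decK : cancel dec enc.
  move=> [i c]; apply/eqP; rewrite -pair_eqE /= -val_eqE /= !enc1 decE /=.
  case: c; rewrite /= ?mul1n ?mul0n ?addn0 ?modnDr modn_small ?ltn_ord // eqxx /=.
    by rewrite leq_addl.
  by rewrite leqNgt ltn_ord.
have [pt' ptK ptK'] := inj_surj_bijective vertex_point_inj vertex_point_surj.
apply: (@coxeter_dihedral_power _ _ s 10 (enc \o vertex_point) (pt' \o dec)) => //.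
- by move=> F /=; rewrite encK ptK.
- by move=> p /=; rewrite ptK' decK.
move=> F F'; rewrite /vertex_matrix /= (inj_eq (can_inj encK)).
rewrite (inj_eq vertex_point_inj) eq_sym; case: eqP => // FF'; congr (if _ then _ else _).
rewrite -(inj_eq vertex_point_inj) -!val_eqE /= vertex_point_alpha !enc1.
have /allP h : all (fun x => all (fun y => (x != y) ==>
   ((y == (x + 10) %% 20) == (x %% 10 == y %% 10))) (iota 0 20))%N (iota 0 20).
  by vm_compute.
have /h/allP hx : (vertex_point F : nat) \in iota 0 20 by rewrite mem_iota ltn_ord.
have /hx/implyP : (vertex_point F' : nat) \in iota 0 20 by rewrite mem_iota ltn_ord.
by move=> /(_ _)/eqP; apply; apply/eqP => /val_inj/vertex_point_inj.
Qed.

Lemma vertex53_neq i : (0 < i < 5)%N ->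
  vertex_mul F0 (beta53 ^+ i) <> F0 /\
  vertex_mul F0 (beta53 ^+ i) <> vertex_mul F0 alpha53.
Proof.
move=> i5; rewrite -{2}(vertex_mul1 F0).
have p k : rep53 (beta53 ^+ k) ord0 = foldl step53 0 (flatten (nseq k [:: 0; 1; 2]))%N
    :> nat.
  by rewrite -nval_expg rep53_nval //; elim: k => //= k ->.
split=> /vertex53_eq /(congr1 val) /=.
  by rewrite -[1](expg0 beta53) !p; case: i i5 => [|[|[|[|[|]]]]].
by rewrite alpha53E !p; case: i i5 => [|[|[|[|[|]]]]].
Qed.

Lemma alpha53_vertex : vertex_mul F0 alpha53 <> F0.
Proof.
rewrite -[X in _ <> X]vertex_mul1 => /vertex53_eq /(congr1 val) /=.
by rewrite rep53_alpha (gmorph1 rep53M) perm1.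
Qed.

Lemma tau53_0_vertex : vertex_mul F0 (tau53 ord0) <> vertex_mul F0 alpha53.
Proof.
have -> : tau53 ord0 = [w [:: 0%N]] by rewrite tau53E /= mulg1.
move=> /vertex53_eq /(congr1 (@nat_of_ord 20)).
by rewrite rep53_alpha rep53_nval.
Qed.

Lemma rho53_string_C s : string_C_group (rho53 s).
Proof. by apply: twisted_string_C; exact: tau53_string_C. Qed.

Lemma rho53_schlafli s : schlafli_type (rho53 s) [:: 4; 5; 3].
Proof.
apply: twisted_schlafli; [exact: tau53_string_C|exact: tau53_schlafli
  |exact: alpha53_invol|exact: tau53_0_vertex].
Qed.

(** * Quotient groups *)

Section NormalQuotient.
Variables (G : groupType) (N : set G).
Hypothesis nN : is_normal_subgroup N.

(** The quotient G / N, presented by all elements of G, a word being a relator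
    when its value lies in N. *)
Definition normal_quotient : groupType :=
  presented [set w : seq (G * bool) | N (weval id w)].

Definition quotient_map (x : G) : normal_quotient := pgen _ x.

Lemma quotient_word_eq u v :
  word_eq [set w : seq (G * bool) | N (weval id w)] u v ->
  N (weval id u * (weval id v)^-1).
Proof.
case: nN => -[N1 NM NV] NJ.
elim=> {u v} [u|u v _ Nuv|u v w _ Nuv _ Nvw|u u' v v' _ Nu _ Nv|x b|r Nr].
- by rewrite mulgV.
- by move/NV: Nuv; rewrite invgM invgK.
- have := NM _ _ Nuv Nvw; by rewrite mulgA mulgVK.
- rewrite !weval_cat invgM; set a := weval id u in Nu *.
  have := NM _ _ (NJ _ a^-1 Nv) Nu.
  by rewrite conjgE invgK !mulgA mulgVK.
- by case: b; rewrite /= invg1 !mulg1 ?mulVg ?mulgV.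
- by rewrite invg1 mulg1.
Qed.

Lemma quotient_mapM : {morph quotient_map : x y / x * y}.
Proof.
case: nN => -[N1 NM NV] NJ.
move=> x y; rewrite /quotient_map presentedM; apply/clsP.
have : word_eq [set w : seq (G * bool) | N (weval id w)]
    [:: (x * y, false); (y, true); (x, true)] [::].
  by apply: word_eq_relator; rewrite /= mulg1 -invgM mulgV.
move=> h; have := word_eq_cat h (word_eq_refl _ [:: (x, false); (y, false)]).
move=> {}h; apply: word_eq_trans h; apply: word_eq_sym.
have cancel_mid u v (z : G) :
    word_eq [set w : seq (G * bool) | N (weval id w)]
      (u ++ [:: (z, true); (z, false)] ++ v) (u ++ v).
  apply: word_eq_cat; first exact: word_eq_refl.
  rewrite -[v in word_eq _ _ v]cat0s.
  apply: word_eq_cat; last exact: word_eq_refl.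
  exact: (word_eq_cancel _ z true).
apply: word_eq_trans (cancel_mid [:: (x * y, false); (y, true)] [:: (y, false)] x) _.
exact: (cancel_mid [:: (x * y, false)] [::] y).
Qed.

Lemma quotient_map_eq1 x : quotient_map x = 1 <-> N x.
Proof.
split=> [/clsP/quotient_word_eq|Nx]; first by rewrite /= mulg1 invg1 mulg1.
by apply/clsP/word_eq_relator; rewrite /= mulg1.
Qed.

End NormalQuotient.

Lemma normal_closure_normal (G : groupType) (A : set G) :
  is_normal_subgroup (normal_closure A).
Proof.
split; [split=> [H [[[]] //]|x y Ax Ay H HA|x Ax H HA]|move=> x y Ax H HA].
- by case: (HA) => -[[_ HM _] _] _; exact: HM (Ax H HA) (Ay H HA).
- by case: (HA) => -[[_ _ HV] _] _; exact: HV (Ax H HA).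
- by case: (HA) => -[_ HJ] _; exact: HJ (Ax H HA).
Qed.

Lemma morph_ker_normal (G H : groupType) (f : G -> H) :
  {morph f : x y / x * y} -> is_normal_subgroup (f @^-1` [set 1]).
Proof.
move=> fM; split; first split=> [|x y /= fx fy|x /= fx].
- exact: gmorph1.
- by rewrite fM fx fy mulg1.
- by rewrite (gmorphV fM) fx invg1.
by move=> x y /= fx; rewrite conjgE !fM fx mul1g -fM mulVg (gmorph1 fM).
Qed.

(** * Presentations *)

Lemma string_C_coxeter_rel (G : groupType) p (rho : 'I_(size p).+1 -> G) i j :
  string_C_group rho -> schlafli_type rho p ->
  (rho i * rho j) ^+ string_matrix i j = 1.
Proof.
move=> sC [_ sp]; rewrite /string_matrix.
have [->|neq] := eqVneq i j; first by rewrite expg1 (rho_invol sC).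
have [/= ij|ij] := eqVneq i.+1 j.
  rewrite -ij minnC /minn ltnNge leqnSn /=.
  by have [_ -> _] := sp i j ij.
have [/= ji|ji] := eqVneq j.+1 i.
  rewrite /= -ji /minn ltnNge leqnSn /=.
  have -> : rho i * rho j = (rho j * rho i)^-1 by rewrite invgM !(rhoV sC).
  by have [_ e _] := sp j i ji; rewrite expVgn e invg1.
case: sC => _; apply; rewrite /= !ltn_neqAle ij ji /=.
by case: ltngtP neq => // /val_inj ->; rewrite eqxx.
Qed.

Definition beta453 : cox453 :=
  cox453_gen (inord 1) * cox453_gen (inord 2) * cox453_gen (inord 3).

(** * The universal property of the twisted power of the dodecahedron *)

Section Lift.
Variables (s : nat) (Q : groupType) (q : 'I_4 -> Q).
Hypothesis q_cox : forall i j, (q i * q j) ^+ @string_matrix [:: 4; 5; 3] i j = 1.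

Let q0 := q ord0.
Let qS (j : 'I_3) := q (lift ord0 j).
Let b := q (inord 1) * q (inord 2) * q (inord 3).

Hypothesis q_short : forall i,
  (2 <= i <= 4)%N -> (q0 * b ^- i * q0 * b ^+ i) ^+ 2 = 1.
Hypothesis q_long : (q0 * b ^+ 5 * q0 * b ^+ 5) ^+ s = 1.

Lemma lift_tau_rel i j : (qS i * qS j) ^+ @string_matrix [:: 5; 3] i j = 1.
Proof.
rewrite -[RHS](q_cox (lift ord0 i) (lift ord0 j)); congr (_ ^+ _).
by case: i j => [[|[|[|?]]] ?] [[|[|[|?]]] ?].
Qed.

Definition lift_tau : cox53 -> Q := plift qS.

Lemma lift_tauM : {morph lift_tau : g h / g * h}.
Proof. exact: pliftM (coxeter_lift_rel lift_tau_rel). Qed.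

Lemma lift_tau_gen j : lift_tau (tau53 j) = qS j.
Proof. exact: plift_gen (coxeter_lift_rel lift_tau_rel) j. Qed.

Lemma q_invol i : q i * q i = 1.
Proof. by have := q_cox i i; rewrite /string_matrix eqxx expg1. Qed.

Lemma q0_commute (j : 'I_3) : j != 0%N :> nat -> commute q0 (qS j).
Proof.
move=> j0; have := q_cox ord0 (lift ord0 j).
have -> : @string_matrix [:: 4; 5; 3] ord0 (lift ord0 j) = 2.
  by case: j j0 => [[|[|[|?]]] ?].
by rewrite expg2 => /invol_inv; rewrite invgM !(invol_inv (q_invol _)).
Qed.

Lemma lift_stab g : vertex_stab tau53 g -> commute q0 (lift_tau g).
Proof.
move: g; apply: (@generated_sub _ _ [set g | commute q0 (lift_tau g)]).
  split=> [|g h /= cg ch|g /= cg] /=.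
  - rewrite (gmorph1 lift_tauM); exact: commute1.
  - by rewrite lift_tauM; exact: commuteM.
  - by rewrite (gmorphV lift_tauM); exact: commuteV.
by move=> _ [j j0 <-] /=; rewrite lift_tau_gen; exact: q0_commute.
Qed.

Lemma lift_beta : lift_tau beta53 = b.
Proof.
rewrite /beta53 /= mulg1 !lift_tauM /t53 !lift_tau_gen /qS /b mulgA.
by congr (q _ * q _ * q _); apply: val_inj; rewrite /= !inordK.
Qed.

(** The image of [sigma F] under the morphism to be constructed. *)
Definition lift_vertex (F : vertex tau53) : Q :=
  q0 ^ lift_tau (sval (cid (vertexP F))).

(** Two elements that carry the base vertex to the same vertex differ by an
    element of its stabilizer, whose image centralizes [q0]. *)
Lemma lift_vertexE g : lift_vertex (vertex_mul F0 g) = q0 ^ lift_tau g.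
Proof.
rewrite /lift_vertex; case: cid => h /= /(eq_vertex tau53 g h) /lift_stab.
set x := h * g^-1 => c; have -> : h = x * g by rewrite /x mulgVK.
by rewrite lift_tauM conjgM [q0 ^ lift_tau x]conjgE c mulKg.
Qed.

Lemma lift_vertexM F g : lift_vertex (vertex_mul F g) = lift_vertex F ^ lift_tau g.
Proof.
by have [h ->] := vertexP F; rewrite -vertex_mulM !lift_vertexE lift_tauM conjgM.
Qed.

Lemma lift_alpha_rel : (q0 * q0 ^ lift_tau alpha53) ^+ s = 1.
Proof.
have bV : (b ^+ 5)^-1 = b ^+ 5.
  apply: invol_inv; rewrite -lift_beta -(gmorphX lift_tauM) -lift_tauM -alpha53E.
  by rewrite alpha53_invol (gmorph1 lift_tauM).
rewrite alpha53E (gmorphX lift_tauM) lift_beta conjgE bV.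
by rewrite -[RHS]q_long !mulgA.
Qed.

Lemma lift_beta_rel i : (0 < i < 5)%N -> (q0 * q0 ^ lift_tau (beta53 ^+ i)) ^+ 2 = 1.
Proof.
case/andP=> i0 i5; rewrite (gmorphX lift_tauM) lift_beta.
have [i1|i1] := leqP 2 i.
  by rewrite -[RHS](q_short (i := i)) ?i1 // conjgE !mulgA.
have -> : i = 1%N by apply/eqP; rewrite eqn_leq -ltnS i1.
(* as [q0] commutes with [c], the relation is conjugate to [(q0 * q1) ^+ 4 = 1] *)
rewrite expg1; pose c := q (inord 2) * q (inord 3).
have cq : q0 ^ c = q0.
  suff cC : commute q0 c by rewrite conjgE cC mulKg.
  have e k (k3 : (k < 3)%N) : inord k.+1 = lift ord0 (Ordinal k3) :> 'I_4.
    by apply: val_inj; rewrite /= inordK.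
  rewrite /c (e 1%N isT) (e 2 isT).
  by apply: commuteM; apply: q0_commute.
have -> : q0 ^ b = (q0 ^ q (inord 1)) ^ c by rewrite -conjgM /b mulgA.
rewrite -{1}cq -conjMg -conjXg.
have q1V := invol_inv (q_invol (inord 1)).
have -> : (q0 * q0 ^ q (inord 1)) ^+ 2 = (q0 * q (inord 1)) ^+ 4.
  rewrite (expgnA _ 2 2) conjgE q1V; congr (_ ^+ _).
  by rewrite expg2 !mulgA.
have := q_cox ord0 (inord 1).
have -> : @string_matrix [:: 4; 5; 3] ord0 (inord 1) = 4%N.
  by rewrite /string_matrix -val_eqE /= inordK.
by move=> ->; rewrite conj1g.
Qed.

(** By conjugation and by the action of the stabilizer of the base vertex, [F]
    becomes the base vertex and [F'] its image under a power of [beta53]. *)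
Lemma lift_vertex_rel F F' :
  (lift_vertex F * lift_vertex F') ^+ vertex_matrix alpha53 s F F' = 1.
Proof.
have v0 : lift_vertex F0 = q0.
  by rewrite -[F0]vertex_mul1 lift_vertexE (gmorph1 lift_tauM) conjg1.
have [g Fg] := vertexP F; rewrite /vertex_matrix.
have qg x y z n : (x * y) ^+ n = 1 -> (x ^ z * y ^ z) ^+ n = 1 :> Q.
  by move=> xy; rewrite -conjMg -conjXg xy conj1g.
case: eqP => [->|FF']; first by rewrite expg1 Fg lift_vertexE -conjMg q_invol conj1g.
case: eqP => [->|FFa].
  rewrite Fg -vertex_mulM -alpha53_central vertex_mulM !lift_vertexM v0.
  by apply: qg; exact: lift_alpha_rel.
have [i [v [i6 Vv F'E]]] := vertex53_orbit (vertex_mul F' g^-1).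
have {}F'E : F' = vertex_mul (vertex_mul F0 (beta53 ^+ i)) (v * g).
  by rewrite -vertex_mulM mulgA vertex_mulM -F'E -vertex_mulM mulVg vertex_mul1.
have {}Fg : F = vertex_mul F0 (v * g).
  rewrite Fg vertex_mulM; congr vertex_mul.
  by rewrite -[LHS]vertex_mul1; apply/eq_vertex; rewrite invg1 mulg1.
have i0 : (0 < i)%N.
  by rewrite lt0n; apply/eqP => i0; apply: FF'; rewrite F'E i0 vertex_mul1 Fg.
have i5 : (i < 5)%N.
  rewrite ltn_neqAle -ltnS i6 andbT; apply/eqP => i5; apply: FFa.
  by rewrite F'E i5 -alpha53E Fg -!vertex_mulM alpha53_central.
rewrite Fg F'E !lift_vertexM v0.
by apply: qg; rewrite lift_beta_rel ?i0.
Qed.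

Definition lift_W : W53 s -> Q := plift lift_vertex.

Lemma lift_WM : {morph lift_W : u v / u * v}.
Proof. exact: pliftM (coxeter_lift_rel lift_vertex_rel). Qed.

Lemma lift_W_gen F : lift_W (sigma alpha53 s F) = lift_vertex F.
Proof. exact: plift_gen (coxeter_lift_rel lift_vertex_rel) F. Qed.

Lemma lift_W_act w g : lift_W (vertex_act w g) = lift_W w ^ lift_tau g.
Proof.
move: w; apply: pmorph_ext => [u v|u v|F].
- by rewrite (vertex_actM alpha53_central) lift_WM.
- by rewrite lift_WM conjMg.
- rewrite -[pgen _ F]/(sigma alpha53 s F) (vertex_act_sigma alpha53_central).
  by rewrite !lift_W_gen lift_vertexM.
Qed.

(** The two factors are compatible because [lift_vertex] is equivariant. *)
Lemma G53_universal : exists psi : G53 s -> Q,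
  {morph psi : x y / x * y} /\ forall i, psi (rho53 s i) = q i.
Proof.
exists (fun x : G53 s => lift_tau (sd1 x) * lift_W (sd2 x)); split.
  move=> [g u] [h v] /=.
  by rewrite lift_tauM lift_WM lift_W_act conjgE -!mulgA mulVKg.
move=> i; rewrite /rho53; case: (unliftP ord0 i) => [j|] ->.
  rewrite twisted_rhoS /= (gmorph1 lift_WM) mulg1; exact: lift_tau_gen.
rewrite twisted_rho0 /= (gmorph1 lift_tauM) mul1g lift_W_gen.
by rewrite -[F0]vertex_mul1 lift_vertexE (gmorph1 lift_tauM) conjg1.
Qed.

End Lift.

Definition cox453_map s : cox453 -> G53 s := plift (rho53 s).

Lemma cox453_rel s i j :
  (rho53 s i * rho53 s j) ^+ @string_matrix [:: 4; 5; 3] i j = 1.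
Proof.
exact: (string_C_coxeter_rel (p := [:: 4; 5; 3]) i j (rho53_string_C s)
  (rho53_schlafli s)).
Qed.

Lemma cox453_mapM s : {morph @cox453_map s : x y / x * y}.
Proof. exact: pliftM (coxeter_lift_rel (@cox453_rel s)). Qed.

Lemma cox453_map_gen s i : cox453_map s (cox453_gen i) = rho53 s i.
Proof. exact: plift_gen (coxeter_lift_rel (@cox453_rel s)) i. Qed.

Lemma cox453_map_surj s : range (@cox453_map s) = setT.
Proof.
apply/seteqP; split=> // x _; have [[gen _ _] _] := rho53_string_C s.
have : generated (range (rho53 s)) x by rewrite gen.
move: x; apply: generated_sub.
  split=> [|_ _ [x _ <-] [y _ <-]|_ [x _ <-]].
  - by exists 1 => //; exact: gmorph1 (@cox453_mapM s).
  - by exists (x * y) => //; exact: cox453_mapM.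
  - by exists x^-1 => //; exact: gmorphV (@cox453_mapM s) x.
by move=> _ [i _ <-]; exists (cox453_gen i) => //; exact: cox453_map_gen.
Qed.

Lemma cox453_map_beta s : cox453_map s beta453 = iota_U tau53 alpha53_central s beta53.
Proof.
have e k (k3 : (k < 3)%N) : inord k.+1 = lift ord0 (inord k) :> 'I_4.
  by apply: val_inj; rewrite /= !inordK // ltnW.
rewrite /beta453 !cox453_mapM !cox453_map_gen /rho53 !e // !twisted_rhoS.
by rewrite -!iota_UM /beta53 /= mulg1 mulgA.
Qed.

(** In the semidirect product, conjugation by an element [g] of [5,3] carries
    the generator attached to the base vertex to the one attached to its image
    under [g]. *)
Lemma rho53_conj s g :
  rho53 s ord0 * (iota_U tau53 alpha53_central s g)^-1 * rho53 s ord0 *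
    iota_U tau53 alpha53_central s g =
  kappa_W alpha53_central (sigma alpha53 s F0 * sigma alpha53 s (vertex_mul F0 g)).
Proof.
rewrite /rho53 twisted_rho0 -(gmorphV (iota_UM tau53 alpha53_central s)) -!mulgA.
by rewrite (mulgA (iota_U _ _ _ _)) -kappa_act actE -kappa_WM.
Qed.

Lemma cox453_map_relators s x : extra_relators s x -> cox453_map s x = 1.
Proof.
have kM := kappa_WM (tau := tau53) alpha53_central (s := s).
have iM := iota_UM tau53 alpha53_central s.
have fM := @cox453_mapM s.
have rel F F' := cgen_rel (vertex_matrix (tau := tau53) alpha53 s) F F'.
have r0 : cox453_map s (cox453_gen (inord 0)) = rho53 s ord0.
  by rewrite cox453_map_gen; congr (rho53 s _); apply: val_inj; rewrite /= inordK.
have bE k : cox453_map s (beta453 ^+ k) =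
    iota_U tau53 alpha53_central s (beta53 ^+ k).
  by rewrite (gmorphX fM) cox453_map_beta (gmorphX iM).
case=> [[i /= i24 <-]|->]; rewrite -/beta453 (gmorphX fM) 3!fM.
  rewrite (gmorphV fM) r0 bE rho53_conj -(gmorphX kM).
  have [|n1 n2] := @vertex53_neq i; first by case/andP: i24 => i2 i4; rewrite ltnS i4 ltnW.
  have := rel F0 (vertex_mul F0 (beta53 ^+ i)); rewrite /vertex_matrix.
  by move/eqP/negPf: n1 => ->; move/eqP/negPf: n2 => -> ->; exact: gmorph1.
rewrite r0 !bE -alpha53E.
have {1}-> : iota_U tau53 alpha53_central s alpha53 =
    (iota_U tau53 alpha53_central s alpha53)^-1.
  by rewrite -(gmorphV iM) (invol_inv alpha53_invol).
rewrite rho53_conj -(gmorphX kM).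
have := rel F0 (vertex_mul F0 alpha53); rewrite /vertex_matrix eqxx.
by move/eqP/negPf: alpha53_vertex => -> ->; exact: gmorph1.
Qed.

(** The universal property, applied to the quotient by the normal closure, factors
    the quotient map through [cox453_map]. *)
Lemma cox453_map_ker s :
  @cox453_map s @^-1` [set 1] = normal_closure (extra_relators s).
Proof.
apply/seteqP; split=> [x fx|]; last first.
  apply: smallest_sub; first exact: morph_ker_normal (@cox453_mapM s).
  exact: cox453_map_relators.
have nN := normal_closure_normal (extra_relators s).
have piM := quotient_mapM nN.
pose q i := quotient_map (normal_closure (extra_relators s)) (cox453_gen i).
have inord0 : inord 0 = ord0 :> 'I_4 by apply: val_inj; rewrite /= inordK.
have rel_q y : extra_relators s y ->
    quotient_map (normal_closure (extra_relators s)) y = 1.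
  by move=> ry; apply/(quotient_map_eq1 nN); exact: sub_gen_smallest.
have [|i i24||psi [psiM psi_gen]] := @G53_universal s _ q.
- move=> i j; rewrite /q -piM -(gmorphX piM) cgen_rel; exact: gmorph1.
- have := rel_q _ (or_introl (ex_intro2 _ _ i i24 erefl)).
  by rewrite (gmorphX piM) !piM (gmorphV piM) (gmorphX piM) !piM inord0.
- have := rel_q _ (or_intror erefl).
  by rewrite (gmorphX piM) 3!piM (gmorphX piM) 2!piM inord0.
apply/(quotient_map_eq1 nN).
rewrite -[RHS](gmorph1 psiM) -fx.
have fM := @cox453_mapM s.
apply: (pmorph_ext (f := quotient_map _) (g := psi \o cox453_map s)) => // [y z|i] /=.
  by rewrite fM psiM.
by rewrite -[pgen _ i]/(cox453_gen i) cox453_map_gen psi_gen.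
Qed.

(** * Cardinalities *)

Lemma bij_card_eq (T U : Type) (f : T -> U) : bijective f -> [set: T] #= [set: U].
Proof.
move=> [g fK gK].
have <- : f @` setT = setT.
  by apply/seteqP; split=> // y _; exists (g y).
by apply/card_esym/inj_card_eq => x y _ _ /(can_inj fK).
Qed.

Lemma card_finType (T : finType) : [set: T] #= `I_#|T|.
Proof.
apply: (card_eq_trans (bij_card_eq (@enum_rank_bij T))).
exact/card_esym/card_II.
Qed.

Lemma cox53_bij : exists f : cox53 -> seq_sub words53, bijective f.
Proof.
exists (fun g => SeqSub (nf53_words g)); apply: inj_surj_bijective.
  by move=> g h [] /(congr1 (nval t53)); rewrite !nf53K.
by move=> [w wP]; exists [w w]; apply: val_inj; rewrite /= nval53K.
Qed.

Lemma G53_card s : (1 < s)%N -> [set: G53 s] #= `I_(120 * (2 * s) ^ 10)%N.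
Proof.
move=> s1; have [h hbij] := W53_dihedral s1; have [f fbij] := cox53_bij.
pose T : finType := (seq_sub words53 * {ffun 'I_10 -> 'D_(2 * s)})%type.
have <- : #|T| = (120 * (2 * s) ^ 10)%N.
  rewrite card_prod card_ffun card_ord card_seq_sub ?uniq_words53 // size_words53.
  by rewrite card_dihedral_type.
apply: card_eq_trans (card_finType T).
apply: (@bij_card_eq _ _ (fun x : G53 s => (f (sd1 x), h (sd2 x)))).
case: fbij hbij => f' fK f'K [h' hK h'K].
exists (fun p => SDPair _ (f' p.1) (h' p.2)) => [[g w]|[x y]] /=.
  by rewrite fK hK.
by rewrite f'K h'K.
Qed.

(** * The polytope *)

Theorem corollary4p3 (s : nat) (s_ge2 : (2 <= s)%N) :
  [/\ regular_polytope (@P53_le s) 4 (@P53_rank s),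
      string_C_group (rho53 s) /\ schlafli_type (rho53 s) [:: 4; 5; 3],
      isomorphic (automorphism_group (@P53_le s)) (G53 s) /\
        isomorphic (W53 s) {ffun 'I_10 -> dihedral s},
      [set: automorphism_group (@P53_le s)] #= `I_(120 * (2 * s) ^ 10)%N &
      exists f : {multiplicative cox453 -> G53 s},
        [/\ forall i, f (cox453_gen i) = rho53 s i,
            range f = setT &
            f @^-1` [set 1] = normal_closure (extra_relators s)]].
Proof.
have sC := rho53_string_C s; have aut := string_C_automorphism sC.
split.
- exact: string_C_regular.
- by split=> //; exact: rho53_schlafli.
- by split=> //; exact: W53_dihedral.
- have [f fbij] := aut.
  exact: card_eq_trans (bij_card_eq fbij) (G53_card s_ge2).
pose m := isMultiplicative.Build _ _ (@cox453_map s) (@cox453_mapM s).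
exists (HB.pack (@cox453_map s) m : {multiplicative cox453 -> G53 s}).
split; [exact: cox453_map_gen|exact: cox453_map_surj|exact: cox453_map_ker].
Qed.
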